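(* Let $w:I\to(0,\infty)$ be a decreasing weight on $I=(0,a)$, $0<a\le\infty$, with $W(t)=\int_0^t w\,dm<\infty$ for all $t\in I$. Let $b=\int_I w\,dm\in(0,\infty]$, $J=(0,b)$, and let $E$ be a fully symmetric Banach function space on $J$ with support $J$. A function $f\in L_1+M_W$ belongs to $Q_{E,w}$ if and only if its level function $f^0$ relative to $w$ belongs to $M_{E,w}$, and then $\|f\|_{Q_{E,w}}=\|f^0\|_{M_{E,w}}$.
   Context: $m$ is Lebesgue measure; functions are identified when equal a.e.; ''decreasing'' means non-increasing. $L^0=L^0(I)$ is the space of real Lebesgue measurable functions on $I$. For a measure $\mu$ and a $\mu$-measurable $f$ on $\Omega$, $d_f^\mu(s)=\mu\{|f|>s\}$ and $f^{*,\mu}(t)=\inf\{s>0:d_f^\mu(s)\le t\}$ for $0\le t<\mu(\Omega)$; $f^*$ is the rearrangement for $\mu=m$, and $f^{*,w}$ the rearrangement with respect to the measure $w\,dm$ on $I$, a function on $J$. For functions on the same interval ($I$ or $J$), $f\prec g$ means $\int_0^x f^*\,dm\le\int_0^x g^*\,dm$ for all $x$ in the interval. A Banach function space on $J$ is a solid linear subspace $E$ of $L^0(J)$ with full support, complete under a monotone norm. It is fully symmetric if equimeasurable functions have equal norms and $f\prec g$, $f\in L^0(J)$, $g\in E$ imply $f\in E$ and $\|f\|_E\le\|g\|_E$. ''Support $J$'' means $\chi_A\in E$ whenever $m(A)<\infty$. $E_w=\{f\in L^0(I):f^{*,w}\in E\}$, $\|f\|_{E_w}=\|f^{*,w}\|_E$;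 $M_{E,w}=\{f\in L^0(I): f^*/w\in E_w\}$ with gauge $\|f\|_{M_{E,w}}=\|f^*/w\|_{E_w}$. $Q_{E,w}$ is the set of $f\in L^0(I)$ such that $f\prec g$ for some $g\in M_{E,w}$, with $\|f\|_{Q_{E,w}}=\inf\{\|g\|_{M_{E,w}}: f\prec g\}$. $M_W=\{f\in L^0(I):\sup_{x\in I}\frac{1}{W(x)}\int_0^x f^*\,dm<\infty\}$ and $L_1+M_W$ is the sum of $L_1(I)$ and $M_W$. Level function (Halperin). For $f\in L^0(I)$ with $f^*$ finite and integrable on the finite intervals $(0,t)$, $t\in I$, and $0\le\alpha<\beta<\infty$, $(\alpha,\beta)\subset I$, put $W(\alpha,\beta)=\int_\alpha^\beta w\,dm$, $F(\alpha,\beta)=\int_\alpha^\beta f^*\,dm$, $R(\alpha,\beta)=F(\alpha,\beta)/W(\alpha,\beta)$, and, if $a=\infty$, $R(\alpha,\infty)=\limsup_{t\to\infty}R(\alpha,t)$. An interval $(\alpha,\beta)\subset I$ ($\beta\le\infty$) is a level interval if $R(\alpha,\beta)>0$ and $R(\alpha,t)\le R(\alpha,\beta)$ for each $t\in(\alpha,\beta)$; it is a maximal level interval if not contained in a larger level interval. Maximal level intervals are pairwise disjoint, hence at most countably many. The level function $f^0$ of $f$ with respect to $w$ is $f^0(t)=R(\alpha,\beta)w(t)$ if $t$ belongs to a maximal level interval $(\alpha,\beta)$, and $f^0(t)=f^*(t)$ otherwise. *)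

(* Defs.v *)
From mathcomp Require Import all_boot all_order all_algebra.
From mathcomp Require Import all_classical all_reals all_analysis.

Set Implicit Arguments.
Unset Strict Implicit.
Unset Printing Implicit Defensive.

Import Order.TTheory GRing.Theory Num.Theory.
Import numFieldNormedType.Exports.

Local Open Scope classical_set_scope.
Local Open Scope ring_scope.
Local Open Scope ereal_scope.

(* The real line with the sigma-algebra of all Lebesgue measurable sets (the
   Caratheodory sigma-algebra of interval length), and the complete Lebesgue
   measure on it. The carrier [Leb R] is convertible to [R]. *)
Notation Leb R := (caratheodory_type ((@wlength R idfun)^*)%mu).
Notation leb := (@completed_lebesgue_measure _).

Section Rearrangements.
Context {R : realType}.
Implicit Types (D A : set R) (f g : R -> R) (mu : set R -> \bar R).

(* The open interval (x, y), where y may be +oo. *)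
Definition oo (x : R) (y : \bar R) : set R := [set t | x%:E < t%:E < y].

(* A function on D is a total function R -> R whose values outside D are
   irrelevant. Functions equal a.e. on D are not quotiented: every notion below
   is invariant under a.e. equality on D. *)
Definition L0 D : set (R -> R) :=
  [set f | measurable_fun (D : set (Leb R)) (f : Leb R -> R)].

Definition ae_on D (P : R -> Prop) : Prop :=
  {ae leb, forall x : Leb R, D x -> P x}.

(* Membership in a class S of real functions on D of a function g whose values
   are a priori in the extended reals: g is a.e. finite on D, and the
   corresponding real function is in S. *)
Definition fin_mem D (S : set (R -> R)) (g : R -> \bar R) : Prop :=
  ae_on D (fun x => g x \is a fin_num) /\ S (fine \o g).

Definition distr D mu f (s : R) : \bar R := mu [set x | D x /\ (s < `|f x|)%R].

(* The value is +oo when no s qualifies. *)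
Definition rearr D mu f (t : R) : \bar R :=
  ereal_inf [set s%:E | s in [set s : R | (0 < s)%R /\ distr D mu f s <= t%:E]].

Definition decr D f : R -> \bar R := rearr D leb f.

(* f is submajorized by g on the interval D = (0, c). *)
Definition subm D f g : Prop := forall x, D x ->
  \int[leb]_(t in oo 0 x%:E) decr D f t <= \int[leb]_(t in oo 0 x%:E) decr D g t.

Definition equimeasurable D f g : Prop :=
  forall s : R, (0 < s)%R -> distr D leb f s = distr D leb g s.

End Rearrangements.

Section FunctionSpaces.
Context {R : realType}.
Variables (D : set R) (E : set (R -> R)) (N : (R -> R) -> R).

Record banach_function_space : Prop := {
  bfs_L0 : E `<=` L0 D;
  bfs_0 : E (cst 0%R);
  bfs_add : forall f g, E f -> E g -> E (fun x => f x + g x)%R;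
  bfs_scale : forall (c : R) f, E f -> E (fun x => c * f x)%R;
  bfs_solid : forall f g, L0 D f -> E g ->
    ae_on D (fun x => (`|f x| <= `|g x|)%R) -> E f;
  bfs_support : forall A : set R, measurable (A : set (Leb R)) -> A `<=` D ->
    leb A < +oo -> E (\1_A);
  bfs_norm_add : forall f g, E f -> E g ->
    (N (fun x => f x + g x) <= N f + N g)%R;
  bfs_norm_scale : forall (c : R) f, E f ->
    N (fun x => c * f x)%R = (`|c| * N f)%R;
  bfs_norm_eq0 : forall f, E f -> N f = 0%R -> ae_on D (fun x => f x = 0%R);
  bfs_norm_monotone : forall f g, E f -> E g ->
    ae_on D (fun x => (`|f x| <= `|g x|)%R) -> (N f <= N g)%R;
  bfs_complete : forall u : nat -> R -> R, (forall n, E (u n)) ->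
    (forall e : R, (0 < e)%R -> exists k : nat, forall i j : nat,
       (k <= i)%N -> (k <= j)%N -> (N (fun x => u i x - u j x) < e)%R) ->
    exists2 f, E f & (N (fun x => u n x - f x)%R) @[n --> \oo] --> (0 : R)%R }.

Record fully_symmetric : Prop := {
  fs_equimeasurable : forall f g, E f -> E g ->
    equimeasurable D f g -> N f = N g;
  fs_subm : forall f g, L0 D f -> E g -> subm D f g -> E f /\ (N f <= N g)%R }.

End FunctionSpaces.

Section WeightedSpaces.
Context {R : realType}.
Variables (a : \bar R) (w : R -> R).

Definition I_a : set R := oo 0%R a.

Definition W (t : R) : \bar R := \int[leb]_(x in oo 0%R t%:E) (w x)%:E.

Definition b_w : \bar R := \int[leb]_(x in I_a) (w x)%:E.

Definition J_w : set R := oo 0%R b_w.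

(* The measure w dm on I_a. *)
Definition wleb (A : set R) : \bar R := \int[leb]_(x in I_a `&` A) (w x)%:E.

Definition decr_w (f : R -> R) : R -> \bar R := rearr I_a wleb f.

Definition L1 : set (R -> R) :=
  [set f | leb.-integrable (I_a : set (Leb R)) (fun x : Leb R => (f x)%:E)].

Definition M_W : set (R -> R) := [set f | L0 I_a f /\
  ereal_sup [set (\int[leb]_(t in oo 0%R x%:E) decr I_a f t) / W x | x in I_a]
    < +oo].

Definition L1_plus_M_W : set (R -> R) := [set f | L0 I_a f /\
  exists g h, [/\ L1 g, M_W h & ae_on I_a (fun x => f x = (g x + h x)%R)]].

Section Spaces.
Variables (E : set (R -> R)) (N : (R -> R) -> R).

Definition E_w : set (R -> R) := [set f | L0 I_a f /\ fin_mem J_w E (decr_w f)].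

Definition norm_E_w (f : R -> R) : R := N (fine \o decr_w f).

Definition decr_div_w (f : R -> R) (t : R) : \bar R := decr I_a f t / (w t)%:E.

Definition M_Ew : set (R -> R) :=
  [set f | L0 I_a f /\ fin_mem I_a E_w (decr_div_w f)].

Definition gauge_M_Ew (f : R -> R) : R := norm_E_w (fine \o decr_div_w f).

Definition Q_Ew : set (R -> R) :=
  [set f | L0 I_a f /\ exists2 g, M_Ew g & subm I_a f g].

Definition gauge_Q_Ew (f : R -> R) : R :=
  inf [set gauge_M_Ew g | g in [set g | M_Ew g /\ subm I_a f g]].

End Spaces.

Section LevelFunction.
Variable f : R -> R.

Definition Rfin (x y : R) : \bar R :=
  (\int[leb]_(t in oo x y%:E) decr I_a f t) /
  (\int[leb]_(t in oo x y%:E) (w t)%:E).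

(* The case y = -oo never occurs for an interval (x, y). *)
Definition Rratio (x : R) (y : \bar R) : \bar R :=
  match y with
  | y'%:E => Rfin x y'
  | +oo => limf_esup (Rfin x) (pinfty_nbhs R)
  | -oo => 0
  end.

Definition level_interval (x : R) (y : \bar R) : Prop :=
  [/\ (0 <= x)%R, x%:E < y, oo x y `<=` I_a, 0 < Rratio x y
    & forall t : R, oo x y t -> Rratio x t%:E <= Rratio x y].

Definition max_level_interval (x : R) (y : \bar R) : Prop :=
  level_interval x y /\
  forall (x' : R) (y' : \bar R), level_interval x' y' ->
    oo x y `<=` oo x' y' -> oo x' y' = oo x y.

(* The maximal level interval containing t, if any, is selected by [cid2]; it is
   unique because maximal level intervals are pairwise disjoint. *)
Definition level_fun (t : R) : \bar R :=
  match pselect (exists2 p : R * \bar R,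
                   max_level_interval p.1 p.2 & oo p.1 p.2 t) with
  | left ex => let p := sval (cid2 ex) in Rratio p.1 p.2 * (w t)%:E
  | right _ => decr I_a f t
  end.

End LevelFunction.

End WeightedSpaces.

(* Main.v *)
(** Write F(x) for the integral of f^* and W(x) for that of w over (0, x), and
    view F as a function of W.  Level intervals are those over which the curve
    (W, F) stays below its chord; a point strictly below some chord lies in a
    level interval, unions of overlapping level intervals are level intervals,
    and hence off the maximal ones the curve has a supporting line.  So the
    primitive of the level function f^0 is the least W-concave majorant Phi of F
    and f^0 = k w a.e. with k decreasing.  In particular f is submajorized by
    f^0, which is its own rearrangement.

    If f is submajorized by g in M_{E,w} and h = g^*/w, then F(x) is at most the
    integral of g^* = h w over (0, x), hence, by Hardy and Littlewood, at most
    H(W(x)), where H is the primitive of h^{*,w}.  Since H is concave, so is the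
    majorant H o W of F as a function of W, and Phi <= H o W; as Phi o W^{-1} is
    the primitive of k^{*,w}, this says that k^{*,w} is submajorized by h^{*,w},
    and full symmetry of E gives the norm inequality. *)
Require Import Defs.
From mathcomp Require Import all_boot all_order all_algebra.
From mathcomp Require Import all_classical all_reals all_analysis.
From mathcomp Require Import measurable_realfun ring lra.

Import Order.TTheory GRing.Theory Num.Theory.
Import numFieldNormedType.Exports.

Set Implicit Arguments.
Unset Strict Implicit.
Unset Printing Implicit Defensive.

Local Open Scope classical_set_scope.
Local Open Scope ring_scope.

(** * Level intervals and supporting lines *)

(** No derivative is taken and W is never inverted as a function: f^0 is tied to F by supporting
    lines alone. At each [x] of I a height [Phi x] and a slope [k x] are chosen such that the
    resulting line lies above F, while no affine function of W above F passes below [Phi x] at [x].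
    These two facts already make [k] decreasing, and [Phi] can be compared with H o W by testing it
    on the supporting lines of H, which are affine. That [Phi] is the integral of k w becomes a
    uniqueness statement: both have increments squeezed between the values of [k] at the two ends
    times the increment of W. Three places resist. At an infinite endpoint R is only an upper limit
    and must be shown finite; near 0 both f^* and w may be unbounded, so [Phi] must be shown to
    start from 0. Both are settled by a bound F <= C1 + C2 W, which is what membership in L_1 + M_W
    provides. Finally, off the level intervals f^* = k w may fail where f^* jumps, hence the
    equality almost everywhere. *)

Section Envelope.
Context {R : realType}.
Variables (a : \bar R) (F V : R -> R).

Definition indom (x : R) : Prop := 0 <= x /\ (x%:E < a)%E.

Definition cont_indom (G : R -> R) : Prop := forall x e, indom x -> 0 < e ->
  exists2 d : R, 0 < d & forall y, indom y -> `|y - x| < d -> `|G y - G x| < e.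

Hypothesis F_cont : cont_indom F.
Hypothesis V_cont : cont_indom V.
Hypothesis F_nd : forall x y, indom x -> indom y -> x <= y -> F x <= F y.
Hypothesis V_incr : forall x y, indom x -> indom y -> x < y -> V x < V y.

(** Shearing the curve by the slope [l]: comparing two values of [tilt l] compares the slope of a
    chord with [l] without forming a quotient. *)
Definition tilt (l x : R) : R := F x - l * V x.

Lemma indom_le x y : 0 <= x -> x <= y -> (y%:E < a)%E -> indom x.
Proof. by move=> x0 xy ya; split=> //; apply: le_lt_trans ya; rewrite lee_fin. Qed.

Lemma indom_lt (be : \bar R) x : 0 <= x -> (x%:E < be)%E -> (be <= a)%E -> indom x.
Proof. by move=> x0 xb ba; split=> //; exact: lt_le_trans ba. Qed.

Lemma tilt_cont l : cont_indom (tilt l).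
Proof.
move=> x e xI e0.
have l1 : 0 < `|l| + 1 by have := normr_ge0 l; lra.
have [d1 d10 H1] := F_cont xI (divr_gt0 e0 (@ltr0n R 2)).
have [d2 d20 H2] := V_cont xI (divr_gt0 (divr_gt0 e0 (@ltr0n R 2)) l1).
exists (Num.min d1 d2); first by rewrite lt_min d10.
move=> y yI; rewrite lt_min => /andP[yd1 yd2].
have h1 := H1 y yI yd1; have h2 := H2 y yI yd2.
have -> : tilt l y - tilt l x = (F y - F x) - l * (V y - V x) by rewrite /tilt; ring.
apply: (le_lt_trans (ler_normB _ _)).
rewrite normrM.
have h3 : `|l| * `|V y - V x| <= e / 2.
  rewrite ltr_pdivlMr// in h2.
  by apply: ltW; apply: le_lt_trans h2; rewrite mulrC ler_wpM2l//; lra.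
lra.
Qed.

Lemma cont_gt (G : R -> R) x c : cont_indom G -> indom x -> c < G x ->
  exists2 d : R, 0 < d & forall y, indom y -> `|y - x| < d -> c < G y.
Proof.
move=> Gc xI cG; have [|d d0 H] := Gc x (G x - c) xI; first by rewrite subr_gt0.
exists d => // y yI /(H y yI); rewrite ltr_norml => /andP[]; lra.
Qed.

Lemma cont_lt (G : R -> R) x c : cont_indom G -> indom x -> G x < c ->
  exists2 d : R, 0 < d & forall y, indom y -> `|y - x| < d -> G y < c.
Proof.
move=> Gc xI cG; have [|d d0 H] := Gc x (c - G x) xI; first by rewrite subr_gt0.
exists d => // y yI /(H y yI); rewrite ltr_norml => /andP[]; lra.
Qed.

(* Level intervals without mention of the slope over (al, be): every tilted
   value above the one at [al] is exceeded arbitrarily close to [be]. This form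
   treats finite and infinite [be] alike and passes to unions. *)
Definition rising (al : R) (be : \bar R) : Prop := forall l s, al < s ->
  (s%:E < be)%E -> tilt l al < tilt l s -> forall M, al < M -> (M%:E < be)%E ->
  exists s', [/\ M < s', (s'%:E < be)%E & tilt l s < tilt l s'].

(** The last clause stands for R(al, be) > 0; [rising] alone also holds where F is constant. *)
Definition rise (al : R) (be : \bar R) : Prop :=
  [/\ 0 <= al, (al%:E < be)%E, (be <= a)%E, rising al be &
   exists2 s, al < s & (s%:E < be)%E /\ F al < F s].

(** Only be1 < be2 needs work. The first interval carries a point up to [al2] past [x]. Beyond
    [al2], a value above the one at [al2] is handled by the second interval; otherwise the value at
    [al2] itself exceeds the one at [al1], so the first interval carries [al2] past [x], where the
    second takes over. *)
Lemma rise_union_le x al1 be1 al2 be2 : al1 <= al2 ->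
  rise al1 be1 -> rise al2 be2 ->
  al2 < x -> (x%:E < be1)%E -> (x%:E < be2)%E -> rise al1 (maxe be1 be2).
Proof.
move=> al12 [al10 ab1 b1a R1 [s1 as1 [sb1 Fs1]]] [al20 ab2 b2a R2 _] ax xb1 xb2.
split=> //.
- by rewrite lt_max ab1.
- by rewrite ge_max b1a.
- have [b21|b12] := leP be2 be1; first exact: R1.
  have step l s : al2 < s -> (s%:E < be2)%E -> tilt l al1 < tilt l s -> forall M, al2 < M ->
      (M%:E < be2)%E -> exists s', [/\ M < s', (s'%:E < be2)%E & tilt l s < tilt l s'].
    move=> als sb Gs M alM Mb.
    have [G2s|Gs2] := ltP (tilt l al2) (tilt l s); first exact: R2.
    have lt12 : al1 < al2.
      rewrite lt_neqAle al12 andbT; apply/eqP => E; move: Gs; rewrite E; lra.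
    have al2b1 : (al2%:E < be1)%E by apply: lt_trans xb1; rewrite lte_fin.
    have G12 : tilt l al1 < tilt l al2 by lra.
    have [s' [xs' s'b G2s']] := R1 l al2 lt12 al2b1 G12 x (lt_trans lt12 ax) xb1.
    have [s'' [Ms'' s''b h]] := R2 l s' (lt_trans ax xs') (lt_trans s'b b12) G2s' M alM Mb.
    by exists s''; split=> //; lra.
  move=> l s als sb Gs M alM Mb.
  have xM : al2 < Num.max x M by rewrite lt_max ax.
  have xMb : ((Num.max x M)%:E < be2)%E by rewrite EFin_max gt_max xb2.
  have [als2|sal2] := ltP al2 s.
    have [s' [h1 h2 h3]] := step l s als2 sb Gs _ xM xMb.
    by exists s'; split=> //; move: h1; rewrite gt_max => /andP[].
  have sb1' : (s%:E < be1)%E by apply: le_lt_trans xb1; rewrite lee_fin; lra.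
  have [s' [h1 h2 h3]] := R1 l s als sb1' Gs x (le_lt_trans al12 ax) xb1.
  have [|s'' [k1 k2 k3]] := step l s' (lt_trans ax h1) (lt_trans h2 b12) _ _ xM xMb.
    by lra.
  exists s''; split=> //; last by lra.
  by move: k1; rewrite gt_max => /andP[].
- by exists s1 => //; split=> //; rewrite lt_max sb1.
Qed.

Lemma rise_union x al1 be1 al2 be2 : rise al1 be1 -> rise al2 be2 ->
  al1 < x -> al2 < x -> (x%:E < be1)%E -> (x%:E < be2)%E ->
  rise (Num.min al1 al2) (maxe be1 be2).
Proof.
move=> r1 r2 a1x a2x xb1 xb2; have [a12|a21] := leP al1 al2.
  exact: (@rise_union_le x _ _ al2).
by rewrite maxC; apply: (@rise_union_le x _ _ al1) => //; exact: ltW.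
Qed.

Definition max_rise (al : R) (be : \bar R) : Prop := rise al be /\
  forall al' be', rise al' be' -> al' <= al -> (be <= be')%E -> al' = al /\ be' = be.

(** The candidate runs from the infimum of the left ends to the supremum of the right ends of all
    level intervals through [x]. By continuity a member with left end near the infimum still starts
    below the tilted value at [s]; its union with a member reaching past [s] and [M] provides the
    point wanted. *)
Lemma max_rise_exists x al be : rise al be -> al < x -> (x%:E < be)%E ->
  exists al' be', [/\ max_rise al' be', al' < x & (x%:E < be')%E].
Proof.
move=> r1 alx xbe.
pose fam (p : R * \bar R) := [/\ rise p.1 p.2, p.1 < x & (x%:E < p.2)%E].
have fam1 : fam (al, be) by [].
pose A := [set p.1 | p in fam]; pose B := [set p.2 | p in fam].
have A_lb : has_lbound A by exists 0 => _ [p [[]] + _ _ _ _ _ _ <-].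
have A_inf : has_inf A by split=> //; exists al; exists (al, be).
have inf_le p : fam p -> inf A <= p.1 by move=> fp; apply: ge_inf => //; exists p.
have sup_ge p : fam p -> (p.2 <= ereal_sup B)%E.
  by move=> fp; apply: ereal_sup_ubound; exists p.
have inf0 : 0 <= inf A by apply: lb_le_inf; [exists al;
  exists (al, be)|move=> _ [p [[]] + _ _ _ _ _ _ <-]].
have r : rise (inf A) (ereal_sup B).
  have supa : (ereal_sup B <= a)%E by apply: ub_ereal_sup => _ [p [[]] _ _ + _ _ _ _ <-].
  split=> //.
  - apply: lt_le_trans (sup_ge _ fam1); apply: le_lt_trans xbe.
    by rewrite lee_fin; apply: le_trans (inf_le _ fam1) _; exact: ltW.
  - move=> l s infs ssup Gs M infM Msup.
    have sI : indom s by apply: (indom_lt _ ssup) => //; lra.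
    have infI : indom (inf A) by apply: (indom_le inf0 (ltW infs)); have [] := sI.
    have [d d0 Hd] := cont_lt (@tilt_cont l) infI Gs.
    have dm : 0 < Num.min d (s - inf A) by rewrite lt_min d0 subr_gt0.
    have [al1 [[al1' be1] /= f1 <-]] := inf_adherent dm A_inf.
    rewrite -ltrBlDl lt_min => /andP[al1d al1s].
    have sM : ((Num.max s M)%:E < ereal_sup B)%E by rewrite EFin_max gt_max ssup.
    have [_ [[al2 be2] /= f2 <-]] := ereal_sup_gt sM.
    rewrite EFin_max gt_max => /andP[sbe2 Mbe2].
    have [r1' a1x xb1] := f1; have [r2' a2x xb2] := f2;
      rewrite /= in r1' r2' a1x a2x xb1 xb2.
    have r3 := rise_union r1' r2' a1x a2x xb1 xb2.
    have f3 : fam (Num.min al1' al2, maxe be1 be2).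
      by split=> //=; rewrite ?gt_min ?lt_max ?a1x ?xb1.
    have [_ _ _ R3 _] := r3.
    have minI : indom (Num.min al1' al2).
      apply: (@indom_le _ al1'); [|by rewrite ge_min lexx|].
        exact: le_trans (inf_le _ f3).
      by case: r1' => _ h1 h2 _ _; apply: lt_le_trans h2.
    have mina : Num.min al1' al2 <= al1' by rewrite ge_min lexx.
    have i3 : inf A <= Num.min al1' al2 := inf_le _ f3.
    have G3 : tilt l (Num.min al1' al2) < tilt l s.
      by apply: Hd => //; rewrite ger0_norm; lra.
    have ms : Num.min al1' al2 < s by lra.
    have sb : (s%:E < maxe be1 be2)%E by rewrite lt_max sbe2 orbT.
    have mM : Num.min al1' al2 < Num.max M s by rewrite lt_max ms orbT.
    have Msb : ((Num.max M s)%:E < maxe be1 be2)%E.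
      by rewrite EFin_max gt_max !lt_max sbe2 Mbe2 !orbT.
    have [s' [h1 h2 h3]] := R3 l s ms sb G3 _ mM Msb.
    exists s'; split=> //; first by move: h1; rewrite gt_max => /andP[].
    exact: lt_le_trans (sup_ge _ f3).
  - have [al0 _ _ _ [s als [sb Fs]]] := r1; exists s.
      by apply: le_lt_trans als; exact: (inf_le _ fam1).
    split; first exact: lt_le_trans (sup_ge _ fam1).
    apply: le_lt_trans Fs; apply: F_nd; last exact: (inf_le _ fam1).
      by apply: (indom_le inf0 (inf_le _ fam1)); case: r1 => _ h1 h2 _ _;
        apply: lt_le_trans h2.
    by split=> //; case: r1 => _ h1 h2 _ _; apply: lt_le_trans h2.
have infx : inf A < x by apply: le_lt_trans alx; exact: (inf_le _ fam1).
have xsup : (x%:E < ereal_sup B)%E by apply: lt_le_trans (sup_ge _ fam1).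
exists (inf A), (ereal_sup B); split=> //; split=> // al' be' r' le1 le2.
have f' : fam (al', be') by split=> //=; [exact: le_lt_trans infx|exact: lt_le_trans le2].
split; apply/eqP; rewrite eq_le.
  by rewrite le1; exact: (inf_le _ f').
by rewrite le2 andbT; exact: (sup_ge _ f').
Qed.

(** A slope strictly between those of the chords from [s] to [x] and from [x] to [t] exists exactly
    when the curve at [x] is strictly below the chord from [s] to [t]. *)
Definition below_chord (x : R) : Prop := exists s t l : R,
  [/\ 0 <= s, s < x, x < t & (t%:E < a)%E /\ F x - F s < l * (V x - V s) /\ l * (V t - V
    x) < F t - F x].

(* Cutting the tilted curve at the height of its lower endpoint gives a level
   interval with both endpoints on the cut. *)
Lemma below_chord_rise x : below_chord x ->
  exists al be, [/\ rise al be%:E, al < x, x < be & (be%:E < a)%E].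
Proof.
move=> [s [t [l0 [s0 sx xt [ta [Fsx Fxt]]]]]].
have tI : indom t by split=> //; lra.
have xI : indom x by apply: (@indom_le _ t) => //; lra.
have sI : indom s by apply: (@indom_le _ t) => //; lra.
have Vsx := V_incr sI xI sx; have Vxt := V_incr xI tI xt.
have Fsx' := F_nd sI xI (ltW sx).
(* For the slope of the whole chord both ends have the same tilted height [c], and [x] lies below
   it; [al] and [be] are the points nearest to [x] on either side where that height is reached
   again. *)
pose l := (F t - F s) / (V t - V s).
have Vst : 0 < V t - V s by lra.
have lE : l * (V t - V s) = F t - F s by rewrite /l divfK// gt_eqF.
have Gst : tilt l s = tilt l t by rewrite /tilt; nra.
have l0p : 0 < l0.
  by rewrite -(pmulr_lgt0 _ (_ : 0 < V x - V s)); lra.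
have lp : 0 < l by apply: divr_gt0 => //; nra.
have Gx : tilt l x < tilt l s.
  rewrite /tilt; have [ll|ll] := leP l l0; first by nra.
  by nra.
set c := tilt l s in Gx Gst *.
pose A := [set y | [/\ 0 <= y, y <= x & c <= tilt l y]].
pose B := [set y | [/\ x <= y, (y <= t) & c <= tilt l y]].
have As : A s by split=> //; lra.
have Bt : B t by split=> //; [lra|rewrite -Gst].
have A_sup : has_sup A by split; [exists s|exists x => y []].
have B_inf : has_inf B by split; [exists t|exists x => y []].
set al := sup A; set be := inf B.
have al_ge y : A y -> y <= al by move=> Ay; apply: ub_le_sup => //; case: A_sup.
have be_le y : B y -> be <= y by move=> By; apply: ge_inf => //; case: B_inf.
have alx : al <= x by apply: ge_sup; [exists s|move=> y []].
have bex : x <= be by apply: lb_le_inf; [exists t|move=> y []].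
have sal : s <= al by exact: al_ge.
have bet : be <= t by exact: be_le.
have alI : indom al by apply: (@indom_le _ t) => //; lra.
have beI : indom be by apply: (@indom_le _ t) => //; lra.
have Gal : c <= tilt l al.
  rewrite leNgt; apply/negP => h; have [d d0 Hd] := cont_lt (@tilt_cont l) alI h.
  have [y Ay yd] := sup_adherent d0 A_sup.
  have yal := al_ge _ Ay; case: Ay => y0 yx yc.
  have yI : indom y by apply: (@indom_le _ t) => //; lra.
  have := Hd y yI; rewrite ler0_norm; last by rewrite subr_le0.
  by rewrite -/al in yd; move=> /(_ ltac:(lra)); lra.
have Gbe : c <= tilt l be.
  rewrite leNgt; apply/negP => h; have [d d0 Hd] := cont_lt (@tilt_cont l) beI h.
  have [y By yd] := inf_adherent d0 B_inf.
  have yal := be_le _ By; case: By => y0 yx yc.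
  have yI : indom y by apply: (@indom_le _ t) => //; lra.
  have := Hd y yI; rewrite ger0_norm; last by rewrite subr_ge0.
  by rewrite -/be in yd; move=> /(_ ltac:(lra)); lra.
have alx' : al < x by rewrite lt_neqAle alx andbT; apply/eqP => E; move: Gal; rewrite E;
  lra.
have bex' : x < be by rewrite lt_neqAle bex andbT; apply/eqP => E; move: Gbe; rewrite -E;
  lra.
have Gin y : al < y -> y < be -> tilt l y < c.
  move=> aly ybe; rewrite ltNge; apply/negP => h.
  have [yx|xy] := leP y x.
    by have := al_ge y; move=> /(_ ltac:(by split=> //; lra)); lra.
  by have := be_le y; move=> /(_ ltac:(by split=> //; lra)); lra.
have Gal' : tilt l al <= c.
  rewrite leNgt; apply/negP => h; have [d d0 Hd] := cont_gt (@tilt_cont l) alI h.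
  pose y := al + Num.min (d / 2) ((x - al)/2).
  have m1 : 0 < Num.min (d / 2) ((x - al)/2) by rewrite lt_min; apply/andP; split; lra.
  have m2 : Num.min (d / 2) ((x - al)/2) <= d / 2 by rewrite ge_min lexx.
  have m3 : Num.min (d / 2) ((x - al)/2) <= (x-al)/2 by rewrite ge_min lexx orbT.
  have yI : indom y by apply: (@indom_le _ t) => //; rewrite /y; lra.
  have := Hd y yI; rewrite ger0_norm; last by rewrite /y; lra.
  move=> /(_ ltac:(rewrite /y; lra)).
  by have := Gin y; move=> /(_ ltac:(rewrite /y; lra) ltac:(rewrite /y; lra)); lra.
have beI0 : 0 <= be by lra.
have VF : V al < V be by apply: V_incr => //; lra.
exists al, be; split=> //; last by case: beI.
split=> //.
- by lra.
- by rewrite lte_fin; lra.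
- by apply: ltW; case: beI.
- move=> m y aly; rewrite lte_fin => ybe Gy M alM; rewrite lte_fin => Mbe.
  have yI : indom y by apply: (@indom_le _ t) => //; lra.
  have Vy := V_incr alI yI aly; have Vy' := V_incr yI beI ybe.
  have gy := Gin y aly ybe.
  (* Between [al] and [be] the curve is below its chord of slope [l], so only a slope smaller than
     [l] can lift [y] above [al]; for such a slope [be] is higher still. *)
  have ml : m < l by move: Gy gy Gal; rewrite /tilt; nra.
  have h : tilt m y < tilt m be by move: Gbe gy; rewrite /tilt; nra.
  have [d d0 Hd] := cont_gt (@tilt_cont m) beI h.
  pose z := Num.max M (be - d / 2).
  have z1 : M <= z by rewrite le_max lexx.
  have z2 : be - d / 2 <= z by rewrite le_max lexx orbT.
  have z3 : z < be by rewrite gt_max Mbe; lra.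
  pose z' := (z + be) / 2.
  have zI : indom z' by apply: (@indom_le _ t) => //; rewrite /z'; lra.
  exists z'; split.
  + by rewrite /z'; lra.
  + by rewrite lte_fin /z'; lra.
  + by apply: Hd => //; rewrite ler0_norm /z'; lra.
- have Fab : F al < F be by move: Gbe Gal'; rewrite /tilt; nra.
  have [d d0 Hd] := cont_gt F_cont beI Fab.
  pose z := Num.max x (be - d / 2).
  have z1 : x <= z by rewrite le_max lexx.
  have z2 : be - d / 2 <= z by rewrite le_max lexx orbT.
  have z3 : z < be by rewrite gt_max bex'; lra.
  have zI : indom z by apply: (@indom_le _ t) => //; lra.
  exists z; first by lra.
  split; first by rewrite lte_fin.
  by apply: Hd => //; rewrite ler0_norm; lra.
Qed.

(** A level interval around [al] would overlap (al, be), and their union would start further to the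
    left. *)
Lemma max_rise_left al be : max_rise al be -> ~ below_chord al.
Proof.
move=> [r m] /below_chord_rise [al' [be' [r' alal' albe' be'a]]].
have [al0 ab _ _ _] := r.
have [x [x1 x2 x3]] : exists x, [/\ al < x, x < be' & (x%:E < be)%E].
  have [bb|bb] := leP be be'%:E.
    move: be ab bb {r m} => [b||]//=; rewrite ?lte_fin ?lee_fin => ab bb.
    by exists ((al + b) / 2); rewrite lte_fin; split; lra.
  exists ((al + be') / 2); split; [lra|lra|].
  by apply: le_lt_trans bb; rewrite lee_fin; lra.
have := rise_union r r' x1 (lt_trans alal' x1) x3; rewrite lte_fin => /(_ x2) r3.
have := m _ _ r3; rewrite ge_min lexx le_max lexx => /(_ isT isT)[+ _].
by rewrite minEle leNgt alal'/=; lra.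
Qed.

Lemma max_rise_right al be : max_rise al be%:E -> ~ below_chord be.
Proof.
move=> [r m] /below_chord_rise [al' [be' [r' alal' albe' be'a]]].
have [al0 + _ _ _] := r; rewrite lte_fin => ab.
pose x := (Num.max al al' + be) / 2.
have mb : Num.max al al' < be by rewrite gt_max ab.
have m1 : al <= Num.max al al' by rewrite le_max lexx.
have m2 : al' <= Num.max al al' by rewrite le_max lexx orbT.
have := @rise_union x _ _ _ _ r r'; rewrite !lte_fin => /(_ ltac:(rewrite /x;
  lra) ltac:(rewrite /x; lra) ltac:(rewrite /x; lra) ltac:(rewrite /x; lra)) r3.
have := m _ _ r3; rewrite ge_min lexx le_max lexx => /(_ isT isT)[_].
by rewrite maxEle lee_fin (ltW albe') => -[]; lra.
Qed.

(* [l] is the upper limit of the slopes over (al, s) as s increases to [be]. *)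
Definition end_slope (al : R) (be : \bar R) (l : R) : Prop :=
  (forall r M, r < l -> al < M -> (M%:E < be)%E ->
     exists s, [/\ M < s, (s%:E < be)%E & r * (V s - V al) < F s - F al]) /\
  (forall r, (forall M, al < M -> (M%:E < be)%E ->
     exists s, [/\ M < s, (s%:E < be)%E & r * (V s - V al) <= F s - F al]) -> r <= l).

Lemma exists_between (al : R) (be : \bar R) : (al%:E < be)%E ->
  exists2 M, al < M & (M%:E < be)%E.
Proof.
move: be => [b||]//=; rewrite ?lte_fin => ab.
  by exists ((al + b) / 2); rewrite ?lte_fin; lra.
by exists (al + 1); [lra|rewrite ltry].
Qed.

(** If [l] dominates the slope to [s], chords from [al] with slope close to [l] and ending near [be]
    end above [s] after any tilt that lifts [s] above [al]. Conversely, tilting by slightly less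
    than the slope to [t], the rising property yields chords near [be] at least that steep, and [l]
    is their upper limit. *)
Lemma level_riseP al be l : 0 <= al -> (al%:E < be)%E -> (be <= a)%E ->
  end_slope al be l ->
  (0 < l /\ forall t, al < t -> (t%:E < be)%E -> F t - F al <= l * (V t - V al)) <->
  rise al be.
Proof.
move=> al0 ab ba [sl1 sl2].
have alI : indom al by exact: (indom_lt _ ab).
have inI s : al < s -> (s%:E < be)%E -> indom s /\ V al < V s.
  move=> als sb; have sI : indom s by apply: indom_lt sb _ => //; lra.
  by split=> //; exact: V_incr.
split=> [[lp Hl]|[_ _ _ ris [s als [sb Fs]]]].
  split=> //; last first.
    have [M alM Mb] := exists_between ab.
    have [s [Ms sb h]] := sl1 _ _ lp alM Mb.
    exists s; first by lra.
    by split=> //; lra.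
  move=> m s als sb Gs M alM Mb.
  have [sI Vs] := inI _ als sb; have h := Hl _ als sb.
  have [M' MM' M'b] : exists2 M', Num.max M s < M' & (M'%:E < be)%E.
    by apply: exists_between; rewrite EFin_max gt_max Mb.
  move: MM'; rewrite gt_max => /andP[MM' sM'].
  have alM' : al < M' by lra.
  have [M'I VM'] := inI _ alM' M'b.
  have sM'V := V_incr sI M'I sM'.
  pose q := (F s - F al) / (V s - V al) - m.
  have qE : (F s - F al) = (q + m) * (V s - V al) by rewrite /q subrK divfK// gt_eqF//
    subr_gt0.
  have q0 : 0 < q by move: Gs; rewrite /tilt; nra.
  have ql : q + m <= l by nra.
  (* Without the factor 1/2, a chord of slope q + m - e from [al] would be at [M'] exactly as high,
     after tilting by [m], as the curve at [s]. With it, such a chord reaching beyond [M'] ends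
     strictly higher. *)
  pose e := q * (V M' - V s) / (V M' - V al) / 2.
  have e0 : 0 < e by rewrite /e !divr_gt0// ?subr_gt0// mulr_gt0// subr_gt0.
  have eE : 2 * e * (V M' - V al) = q * (V M' - V s).
    rewrite /e; field; rewrite gt_eqF//; lra.
  have [|z [M'z zb hz]] := sl1 (q + m - e) M' _ alM' M'b; first by lra.
  have alz : al < z by lra.
  have [zI Vz] := inI _ alz zb.
  have VM'z := V_incr M'I zI M'z.
  exists z; split=> //; first by lra.
  rewrite /tilt.
  have qe : 0 <= q - e.
    have : 2 * e * (V M' - V al) <= q * (V M' - V al) by rewrite eE ler_wpM2l; lra.
    rewrite ler_pM2r; last by lra.
    by lra.
  have k1 : (q - e) * (V M' - V al) <= (q - e) * (V z - V al) by rewrite ler_wpM2l; lra.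
  have k2 : 0 < e * (V M' - V al) by rewrite mulr_gt0//; lra.
  by nra.
have key t : al < t -> (t%:E < be)%E -> F t - F al <= l * (V t - V al).
  move=> alt tb; have [tI Vt] := inI _ alt tb.
  pose q := (F t - F al) / (V t - V al).
  have qE : (F t - F al) = q * (V t - V al) by rewrite /q divfK// gt_eqF// subr_gt0.
  rewrite qE ler_wpM2r//; first by lra.
  apply/ler_addgt0Pl => e e0; rewrite -lerBlDl; apply: sl2 => M alM Mb.
  have [|z [h1 h2 h3]] := ris (q - e) t alt tb _ M alM Mb.
    by rewrite /tilt; nra.
  have [zI Vz] := inI z ltac:(lra) h2.
  exists z; split=> //; apply: ltW; move: h3; rewrite /tilt; nra.
split=> //.
have [sI Vs] := inI _ als sb; have := key _ als sb.
by move=> h; rewrite -(pmulr_lgt0 _ (_ : 0 < V s - V al)); lra.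
Qed.

(** Inside the interval this is the level property. Outside, a violation would put an endpoint
    strictly below a chord, which maximality forbids. *)
Lemma max_rise_dominates al be l : max_rise al be -> end_slope al be l ->
  forall t, indom t -> F t - F al <= l * (V t - V al).
Proof.
move=> mr es t tI.
have [[al0 ab ba ris _] _] := mr; have [r _] := mr.
have [lp Hl] := (level_riseP al0 ab ba es).2 r.
have alI : indom al by exact: (indom_lt _ ab).
have [tal|alt|->] := ltgtP t al; last by rewrite !subrr mulr0.
  (* otherwise [al] lies below a chord issued from [t] *)
  rewrite leNgt; apply/negP => h.
  have Vt := V_incr tI alI tal.
  pose q := (F al - F t) / (V al - V t).
  have qE : (F al - F t) = q * (V al - V t) by rewrite /q divfK// gt_eqF// subr_gt0.
  have ql : q < l by nra.
  pose r' := (q + l) / 2.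
  have [M alM Mb] := exists_between ab.
  have [|s [Ms sb hs]] := (es.1) r' M _ alM Mb; first by rewrite /r'; lra.
  apply: (max_rise_left mr); exists t, s, r'.
  split; [by case: tI|by []|lra|split; [exact: lt_le_trans ba|split]].
    by rewrite qE /r'; nra.
  by lra.
have [tb|bt] := ltP t%:E be; first exact: Hl.
move: be ab ba ris mr es r Hl bt => [b||]; rewrite ?lte_fin ?lee_fin//.
move=> alb ba ris mr es r Hl bt.
have bI : indom b.
  by apply: (@indom_le _ t) => //; [lra|case: tI].
have Vb := V_incr alI bI alb.
(* At a finite right end inside the domain, continuity turns the upper limit [l] into the slope of
   the full chord. *)
have Eb : F b - F al = l * (V b - V al).
  apply/eqP; rewrite eq_le; apply/andP; split.
    pose q := (F b - F al) / (V b - V al).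
    have qE : (F b - F al) = q * (V b - V al) by rewrite /q divfK// gt_eqF// subr_gt0.
    rewrite qE ler_wpM2r//; first by lra.
    apply/ler_addgt0Pl => e e0; rewrite -lerBlDl; apply: (es.2) => M alM;
      rewrite lte_fin => Mb.
    have h : tilt (q - e) al < tilt (q - e) b by rewrite /tilt; nra.
    have [d d0 Hd] := cont_gt (@tilt_cont (q - e)) bI h.
    pose z := Num.max M (b - d / 2).
    have z1 : M <= z by rewrite le_max lexx.
    have z2 : b - d / 2 <= z by rewrite le_max lexx orbT.
    have z3 : z < b by rewrite gt_max Mb; lra.
    exists ((z + b) / 2).
    have zI : indom ((z + b) / 2) by apply: (@indom_le _ b) => //; [lra|lra|case: bI].
    split; [lra|by rewrite lte_fin; lra|].
    have := Hd _ zI; rewrite ler0_norm; last by lra.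
    by move=> /(_ ltac:(lra)); rewrite /tilt; lra.
  rewrite leNgt; apply/negP => h.
  pose q := (F b - F al) / (V b - V al).
  have qE : (F b - F al) = q * (V b - V al) by rewrite /q divfK// gt_eqF// subr_gt0.
  have ql : q < l by rewrite qE in h; nra.
  pose m := (q + l) / 2.
  have h' : tilt m b < tilt m al by rewrite /tilt /m; nra.
  have [d d0 Hd] := cont_lt (@tilt_cont m) bI h'.
  pose z := Num.max ((al + b) / 2) (b - d / 2).
  have z1 : (al + b) / 2 <= z by rewrite le_max lexx.
  have z2 : b - d / 2 <= z by rewrite le_max lexx orbT.
  have z3 : z < b by rewrite gt_max; apply/andP; split; lra.
  have ml : m < l by rewrite /m; lra.
  have alz : al < z by lra.
  have zb : (z%:E < b%:E)%E by rewrite lte_fin.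
  have [s [zs + hs]] := (es.1) m z ml alz zb; rewrite lte_fin => sb.
  have sI : indom s by apply: (@indom_le _ b) => //; [lra|lra|case: bI].
  have := Hd s sI; rewrite ler0_norm; last by lra.
  by move=> /(_ ltac:(lra)); rewrite /tilt; lra.
have [->|bt'] := eqVneq t b; first by rewrite Eb.
have {bt bt'} bt : b < t by rewrite lt_neqAle eq_sym bt' bt.
(* otherwise [b] lies below a chord issued from [al] *)
rewrite leNgt; apply/negP => h.
have Vt := V_incr bI tI bt.
pose q := (F t - F b) / (V t - V b).
have qE : (F t - F b) = q * (V t - V b) by rewrite /q divfK// gt_eqF// subr_gt0.
have ql : l < q by nra.
apply: (max_rise_right mr); exists al, t, ((q + l) / 2).
split=> //; split; [by case: tI|split]; first by rewrite Eb; nra.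
by rewrite qE; nra.
Qed.

(** The infimum of the slopes of chords arriving from the left works: a steeper chord leaving to the
    right would, with some chord on the left, place [x] below a chord. *)
Lemma contact_slope x : indom x -> 0 < x -> ~ below_chord x ->
  exists l, forall t, indom t -> F t - F x <= l * (V t - V x).
Proof.
move=> xI x0 nbc.
pose slope s := (F x - F s) / (V x - V s).
pose S := [set slope s | s in [set s | 0 <= s < x]].
have slopeE s : 0 <= s < x -> F x - F s = slope s * (V x - V s).
  move=> /andP[s0 sx]; rewrite /slope divfK// gt_eqF// subr_gt0; apply: V_incr => //.
  by apply: (@indom_le _ x) => //; [lra|case: xI].
have S0 : S !=set0 by exists (slope 0); exists 0 => //=; rewrite lexx.
have Slb : has_lbound S.
  exists 0 => _ [s /= /andP[s0 sx] <-];
    have sI : indom s by apply: (@indom_le _ x) => //; [lra|case: xI].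
  by apply: divr_ge0; rewrite subr_ge0; [apply: F_nd => //; lra|apply: ltW; exact: V_incr].
exists (inf S) => t tI.
have [tx|xt|->] := ltgtP t x; last by rewrite !subrr mulr0.
  have t0 : 0 <= t < x by case: tI => -> _.
  have h := slopeE _ t0.
  have : inf S <= slope t by apply: ge_inf => //; exists t.
  by have := V_incr tI xI tx; nra.
rewrite leNgt; apply/negP => h.
have Vt := V_incr xI tI xt.
pose q := (F t - F x) / (V t - V x).
have qE : (F t - F x) = q * (V t - V x) by rewrite /q divfK// gt_eqF// subr_gt0.
have ql : inf S < q by nra.
have [|_ [s s0 <-]] := @inf_adherent _ S (q - inf S) _ (conj S0 Slb); first by lra.
rewrite addrCA subrr addr0 => sq.
apply: nbc; have [s0' sx] := andP s0; exists s, t, ((q + slope s) / 2).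
have sI : indom s by apply: (@indom_le _ x) => //; [lra|case: xI].
have Vs := V_incr sI xI sx.
split=> //; split; first by case: tI.
by rewrite (slopeE _ s0) qE; split; nra.
Qed.

(** A chord from [al] of slope close to [l] ends beyond [x]; an affine majorant lies above both its
    ends, hence above it at [x]. This makes the chord over a level interval minimal, even for an
    infinite right end. *)
Lemma end_slope_le_affine al be l c m x : 0 <= al -> (be <= a)%E -> end_slope al be l ->
  (forall t, indom t -> F t <= c + m * V t) ->
  al < x -> (x%:E < be)%E -> F al + l * (V x - V al) <= c + m * V x.
Proof.
move=> al0 ba es H alx xb.
have xI : indom x by apply: indom_lt xb _ => //; lra.
have alI : indom al by apply: (@indom_le _ x) => //; [lra|case: xI].
have Vx := V_incr alI xI alx.
suff: l <= (c + m * V x - F al) / (V x - V al).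
  by rewrite ler_pdivlMr; lra.
apply/ler_addgt0Pl => e e0.
have [|s [xs sb hs]] := (es.1) (l - e) x _ alx xb; first by lra.
have sI : indom s by apply: indom_lt sb _ => //; lra.
have Vs := V_incr xI sI xs.
have h1 := H _ alI; have h2 := H _ sI.
rewrite -lerBlDl ler_pdivlMr; last by lra.
set p := l - e in hs *.
rewrite leNgt; apply/negP => h.
have : (p - m) * (V s - V al) < c + m * V al - F al by lra.
have : c + m * V al - F al < (p - m) * (V x - V al) by lra.
nra.
Qed.

End Envelope.

(* Two primitives of k dW: their increments over a fine subdivision differ by a
   telescoping sum times the mesh. *)
Lemma primitive_unique (R : realType) (k V G H : R -> R) (p q L : R) : p <= q -> 0 <= L ->
  (forall x y, p <= x -> x <= y -> y <= q -> V y - V x <= L * (y - x)) ->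
  (forall x y, p <= x -> x <= y -> y <= q -> k y <= k x) ->
  (forall x y, p <= x -> x <= y -> y <= q ->
     k y * (V y - V x) <= G y - G x <= k x * (V y - V x)) ->
  (forall x y, p <= x -> x <= y -> y <= q ->
     k y * (V y - V x) <= H y - H x <= k x * (V y - V x)) ->
  G q - G p = H q - H p.
Proof.
move=> pq L0 VL kni HG HH.
pose E x := (G x - G p) - (H x - H p).
have step n (d : R) : 0 <= d -> p + n%:R * d <= q ->
    `|E (p + n%:R * d)| <= (k p - k (p + n%:R * d)) * (L * d).
  move=> d0; elim: n => [|n IH] nq.
    by rewrite mul0r addr0 /E !subrr mul0r normr0.
  have nS : p + n.+1%:R * d = (p + n%:R * d) + d by rewrite -natr1; ring.
  rewrite nS in nq *; set x := p + n%:R * d in nq IH *; set y := x + d.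
  have px : p <= x by rewrite /x lerDl mulr_ge0.
  have xy : x <= y by rewrite /y lerDl.
  have {}IH : `|E x| <= (k p - k x) * (L * d) by apply: IH; lra.
  have /andP[g1 g2] := HG x y px xy nq; have /andP[h1 h2] := HH x y px xy nq.
  have v1 := VL x y px xy nq; have k1 := kni x y px xy nq.
  have yx : y - x = d by rewrite /y; ring.
  rewrite yx in v1.
  have b : `|E y - E x| <= (k x - k y) * (L * d).
    apply: (@le_trans _ _ ((k x - k y) * (V y - V x)));
      last by rewrite ler_wpM2l// subr_ge0.
    by rewrite /E ler_norml; apply/andP; split; lra.
  have -> : E y = E x + (E y - E x) by ring.
  apply: le_trans (ler_normD _ _) _; lra.
have Eq0 : E q = 0.
  apply/eqP; rewrite -normr_eq0 eq_le normr_ge0 andbT.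
  pose C := (k p - k q) * (L * (q - p)).
  have bnd n : (0 < n)%N -> `|E q| * n%:R <= C.
    move=> n0; have n0' : (0 : R) < n%:R by rewrite ltr0n.
    have e : p + n%:R * ((q - p) / n%:R) = q by rewrite mulrC divfK ?gt_eqF//; ring.
    have := step n ((q - p) / n%:R); rewrite e; move=> /(_ _ (lexx q)) h.
    have {}h := h ltac:(by rewrite divr_ge0// subr_ge0).
    rewrite -ler_pdivlMr//; apply: le_trans h _; rewrite /C.
    by rewrite -!mulrA.
  rewrite leNgt; apply/negP => E0.
  have := bnd (Num.truncn (C / `|E q|)).+1 isT; rewrite leNgt => /negP; apply.
  by rewrite mulrC -ltr_pdivrMr//; exact: truncnS_gt.
by move: Eq0; rewrite /E; lra.
Qed.

Local Open Scope ereal_scope.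

(** * Integrals over intervals and the layer cake formula *)

Section Intervals.
Context {R : realType}.
Notation leb := (@completed_lebesgue_measure R).

Lemma ooE (x : R) (y : R) : oo x y%:E = [set` `]x, y[%R].
Proof. by apply/seteqP; split=> t; rewrite /oo /= !lte_fin in_itv. Qed.

Lemma is_interval_oo (x : R) (y : \bar R) : is_interval (oo x y).
Proof.
move=> s t /= /andP[xs _] /andP[_ ty] z /andP[sz zt]; rewrite /oo /=.
by rewrite (lt_le_trans xs) ?lee_fin//= (le_lt_trans _ ty)// lee_fin.
Qed.

Lemma measurable_interval (A : set R) : is_interval A -> measurable (A : set (Leb R)).
Proof. by move=> iA; apply: sub_caratheodory;
  exact: measurable_realfun.is_interval_measurable. Qed.

Lemma measurable_oo (x : R) (y : \bar R) : measurable (oo x y : set (Leb R)).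
Proof. by apply: measurable_interval; exact: is_interval_oo. Qed.

Lemma lebE (A : set R) : leb A = lebesgue_measure A.
Proof. by []. Qed.

Lemma leb_oo (x : R) (y : \bar R) : x%:E <= y -> leb (oo x y) = y - x%:E.
Proof.
case: y => [y| |] //=; rewrite ?lee_fin => xy.
  rewrite ooE lebE lebesgue_measure_itv/= lte_fin; case: ltP => //= yx.
  have -> : x = y by apply/eqP; rewrite eq_le xy.
  by rewrite subee.
have -> : oo x +oo = [set` `]x, +oo[%R].
  by apply/seteqP; split=> t; rewrite /oo /= lte_fin ltry in_itv/=.
by rewrite lebE lebesgue_measure_itv/= ltry.
Qed.

Lemma leb_oo0 (y : \bar R) : 0 <= y -> leb (oo 0 y) = y.
Proof. by move=> y0; rewrite leb_oo// sube0. Qed.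

(** Superlevel sets of such a function are intervals. *)
Lemma noninc_measurable (D : set R) (h : R -> \bar R) : is_interval D ->
  (forall x y, D x -> D y -> (x <= y)%R -> h y <= h x) ->
  measurable_fun (D : set (Leb R)) (fun x : Leb R => h x).
Proof.
move=> iD hni; apply: (measurability _ (ErealGenOInfty.measurableE R)).
move=> _ /= [_ [r ->] <-].
apply: measurable_interval => s t /= [Ds hs] [Dt ht] z szt.
have Dz := iD s t Ds Dt z szt; split=> //; move: ht; rewrite /= !in_itv/= !andbT.
by move=> /lt_le_trans; apply; apply: hni => //; case/andP: szt.
Qed.

(** Monotone convergence along the intervals from q/n to q; it deals with integrands unbounded at
    0. *)
Lemma int_oo0_le (g : R -> \bar R) (q : R) (M : \bar R) : (0 < q)%R ->
  measurable_fun (oo 0 q%:E : set (Leb R)) (fun t : Leb R => g t) ->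
  (forall t, oo 0 q%:E t -> 0 <= g t) ->
  (forall p, (0 < p)%R -> (p <= q)%R -> \int[leb]_(t in oo p q%:E) g t <= M) ->
  \int[leb]_(t in oo 0 q%:E) g t <= M.
Proof.
move=> q0 mg g0 H.
pose G n : set (Leb R) := oo (q / n.+1%:R)%R q%:E.
have qn0 n : (0 < q / n.+1%:R)%R by rewrite divr_gt0// ltr0n.
have Gnd : {homo G : n m / (n <= m)%N >-> (n <= m)%O}.
  move=> n m nm; apply/subsetPset => t; rewrite /G /oo /= => /andP[h1 ->]; rewrite andbT.
  apply: le_lt_trans h1; rewrite lee_fin ler_pM2l// lef_pV2 ?posrE ?ltr0n// ler_nat//.
have GU : \bigcup_n G n = oo 0 q%:E.
  apply/seteqP; split=> t; rewrite /G /oo /=.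
    by move=> [n _ /andP[h1 ->]]; rewrite andbT; apply: le_lt_trans h1; rewrite lee_fin ltW.
  rewrite !lte_fin => /andP[t0 tq]; exists (Num.truncn (q / t)) => //=.
  by rewrite !lte_fin tq andbT ltr_pdivrMr ?ltr0n// mulrC -ltr_pdivrMr//; exact: truncnS_gt.
have mG n : measurable (G n) by exact: measurable_oo.
have sub n : G n `<=` oo 0 q%:E by rewrite -GU; exact: bigcup_sup.
have mgG n : measurable_fun (G n) (fun t : Leb R => g t).
  by apply: (@measurable_funS _ _ (Leb R) _ (oo 0 q%:E)) => //; exact: measurable_oo.
have gG n (t : Leb R) : G n t -> 0 <= g t by move=> /sub; exact: g0.
have cv := @ge0_nondecreasing_set_cvg_integral _ (Leb R) R G g leb Gnd mG mgG gG.
have nd := @ge0_nondecreasing_set_nondecreasing_integral _ (Leb R) R G g leb Gnd mG mgG gG.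
have cv' := ereal_nondecreasing_cvgn nd.
have := cvg_unique _ cv cv'; rewrite GU => /(_ (@ereal_hausdorff R)) ->.
apply: ge_ereal_sup => _ [n _ <-]; apply: H => //.
by rewrite ler_pdivrMr ?ltr0n// ler_peMr ?ler1n// ltW.
Qed.

End Intervals.

Section LayerCake.
Context {R : realType}.
Notation leb := (@completed_lebesgue_measure R).

(** Tonelli for the region 0 < s < h(x) with density [v] in [x]. The variable [x] carries the
    completed sigma-algebra and the level [s] the Borel one. The measurability of the layer masses
    allows two such integrals to be compared. *)
Lemma layer_cake (D : set R) (v : R -> R) (h : R -> \bar R) :
  measurable (D : set (Leb R)) ->
  measurable_fun (D : set (Leb R)) (v : Leb R -> R) -> (forall x, D x -> (0 <= v x)%R) ->
  measurable_fun (D : set (Leb R)) (fun x : Leb R => h x) -> (forall x, D x -> 0 <= h x) ->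
  let m s := \int[leb]_(x in D `&` [set x | s%:E < h x]) (v x)%:E in
  \int[leb]_(x in D) ((v x)%:E * h x) =
    \int[lebesgue_measure]_(s in (`]0%R, +oo[%classic : set R)) m s /\
  measurable_fun [set: measurableTypeR R] (m \_ (`]0%R, +oo[%classic : set R)).
Proof.
move=> mD mv v0 mh h0 m.
pose h' : Leb R -> \bar R := h \_ D.
have mh' : measurable_fun [set: Leb R]
  h' by exact: (@measurable_restrictT _ _ (Leb R) _ D h mD).1 mh.
pose v' : Leb R -> \bar R := (fun x => (v x)%:E) \_ D.
have mv' : measurable_fun [set: Leb R] v'.
  exact: (@measurable_restrictT _ _ (Leb R) _ D (fun x => (v x)%:E) mD).1
    ((measurable_EFinP (T := Leb R) D v).2 mv).
have v'0 x : 0 <= v' x by rewrite /v' patchE; case: ifPn => // /set_mem /v0;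
  rewrite lee_fin.
pose S : set (Leb R * measurableTypeR R) := [set z | (0 < z.2)%R && (z.2%:E < h' z.1)].
have mS : measurable S.
  have -> : S = ([set: Leb R] `*` (`]0%R, +oo[%classic : set R)) `&`
               ([set: _] `&` [set z : Leb R * measurableTypeR R | z.2%:E < h' z.1]).
    apply/seteqP; split=> z; rewrite /S /= in_itv/= andbT.
      by move=> /andP[].
    by move=> [[_ ->] [_ ->]].
  apply: measurableI.
    by apply: measurableX => //; exact: measurable_itv.
  apply: measurable_lte => //.
    by apply/measurable_EFinP; exact: measurable_snd.
  by apply: measurableT_comp => //; exact: measurable_fst.
pose G : Leb R * measurableTypeR R -> \bar R := fun z => v' z.1 * (\1_S z)%:E.
have mG : measurable_fun [set: Leb R * measurableTypeR R] G.
  apply: emeasurable_funM; first by apply: measurableT_comp => //; exact: measurable_fst.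
  by apply/measurable_EFinP; exact: measurable_indic.
have G0 z : 0 <= G z by rewrite mule_ge0// lee_fin.
have GE s : \int[leb]_x G (x, s) = (m \_ (`]0%R, +oo[%classic : set R)) s.
  rewrite patchE; case: ifPn => [|/negP]; rewrite inE /= in_itv /= andbT => s0.
    rewrite /m [RHS]integral_mkcond; apply: eq_integral => x _.
    rewrite /G /v' /= indicE !patchE.
    have [xD|xD] := boolP (x \in D); last first.
      rewrite mul0e ifF//; apply/negP => /set_mem [/mem_set]; by rewrite (negbTE xD).
    have -> : ((x, s) \in S) = (x \in D `&` [set x0 | s%:E < h x0]).
      apply/idP/idP => /set_mem.
        rewrite /S /= s0 /h' patchE xD => hs; apply/mem_set; split=> //; exact: set_mem.
      by move=> [_ hs]; apply/mem_set; rewrite /S /= s0 /h' patchE xD.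
    by case: ifP => _; rewrite ?mule1 ?mule0.
  rewrite integral0_eq// => x _; rewrite /G indicE memNset ?mule0// /S /=.
  by case/andP => /s0.
have key := @fubini_tonelli _ _ _ _ _ leb (@lebesgue_measure R) G mG G0.
split; last first.
  have := @measurable_fun_fubini_tonelli_G _ _ _ _ _ leb G mG G0.
  by rewrite (_ : fubini_G leb G = (m \_ (`]0%R, +oo[%classic : set R)))//;
    apply/funext => s; exact: GE.
rewrite [RHS]integral_mkcond.
under [RHS]eq_integral do rewrite -GE.
rewrite -key [LHS]integral_mkcond; apply: eq_integral => x _; rewrite patchE.
rewrite /G /=; under eq_integral do rewrite muleC.
have mSx : measurable ([set s | S (x, s)] : set (measurableTypeR R)).
  have := measurable_xsection x mS; congr measurable.
  by apply/seteqP; split=> s; rewrite /xsection /= inE.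
have v'E : v' x = if x \in D then (v x)%:E else 0 by rewrite /v' patchE.
have -> : \int[lebesgue_measure]_s ((\1_S (x, s))%:E * v' x) = 
   \int[lebesgue_measure]_s (v' x * (\1_([set s | S (x, s)] : set R) s)%:E).
  by apply: eq_integral => s _; rewrite muleC !indicE.
have v'fin : v' x \is a fin_num by rewrite v'E; case: ifP.
rewrite -(fineK v'fin) ge0_integralZl_EFin ?fine_ge0//; last first.
  by apply/measurable_EFinP; exact: measurable_indic.
rewrite integral_indic// setIT fineK// v'E.
case: ifPn => xD; last by rewrite mul0e.
congr (_ * _).
have -> : [set s | S (x, s)] = oo 0 (h x).
  by apply/seteqP; split=> s; rewrite /S /oo /= /h' patchE xD lte_fin.
exact: esym (leb_oo0 (h0 _ (set_mem xD))).
Qed.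

(** The common engine of the rearrangement inequalities: by layers, only the masses of superlevel
    sets matter, even across different domains and weights. *)
Lemma le_integral_distr (D1 D2 : set R) (v1 v2 : R -> R) (h1 h2 : R -> \bar R) :
  measurable (D1 : set (Leb R)) -> measurable (D2 : set (Leb R)) ->
  measurable_fun (D1 : set (Leb R)) (v1 : Leb R -> R) -> (forall x, D1 x ->
    (0 <= v1 x)%R) ->
  measurable_fun (D2 : set (Leb R)) (v2 : Leb R -> R) -> (forall x, D2 x ->
    (0 <= v2 x)%R) ->
  measurable_fun (D1 : set (Leb R)) (fun x : Leb R => h1 x) -> (forall x, D1 x ->
    0 <= h1 x) ->
  measurable_fun (D2 : set (Leb R)) (fun x : Leb R => h2 x) -> (forall x, D2 x ->
    0 <= h2 x) ->
  (forall s : R, (0 < s)%R ->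
     \int[leb]_(x in D1 `&` [set x | s%:E < h1 x]) (v1 x)%:E <=
     \int[leb]_(x in D2 `&` [set x | s%:E < h2 x]) (v2 x)%:E) ->
  \int[leb]_(x in D1) ((v1 x)%:E * h1 x) <= \int[leb]_(x in D2) ((v2 x)%:E * h2 x).
Proof.
move=> mD1 mD2 mv1 v10 mv2 v20 mh1 h10 mh2 h20 H.
have [-> m1] := layer_cake mD1 mv1 v10 mh1 h10.
have [-> m2] := layer_cake mD2 mv2 v20 mh2 h20.
have mI : measurable (`]0%R, +oo[%classic : set (measurableTypeR R)) by exact:
  measurable_itv.
apply: ge0_le_integral; first exact: mI.
- by move=> s _; apply: integral_ge0 => x [/v10]; rewrite lee_fin.
- exact: (measurable_restrictT _ mI).2.
- exact: (measurable_restrictT _ mI).2.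
- by move=> s; rewrite /= in_itv/= andbT => /H.
Qed.

End LayerCake.

(** * Decreasing rearrangements *)

Section Rearrangement.
Context {R : realType}.
Notation leb := (@completed_lebesgue_measure R).

Section Galois.
Variables (D : set R) (mu : set R -> \bar R) (f : R -> R).

(** What makes [rearr] a generalised inverse of the distribution function; the last clause is right
    continuity. *)
Definition regular_distr : Prop :=
  [/\ forall s, 0 <= distr D mu f s,
      forall s s', (s <= s')%R -> distr D mu f s' <= distr D mu f s &
      forall s t, t < distr D mu f s -> exists2 s', (s < s')%R & t < distr D mu f s'].

Lemma rearr_ge0 t : 0 <= rearr D mu f t.
Proof. by apply: le_ereal_inf_tmp => _ [s [s0 _] <-]; rewrite lee_fin ltW. Qed.

Lemma rearr_noninc t t' : (t <= t')%R -> rearr D mu f t' <= rearr D mu f t.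
Proof.
move=> tt'; apply: ereal_inf_le_tmp => _ [s [s0 ds] <-]; exists s => //; split=> //.
by apply: le_trans ds _; rewrite lee_fin.
Qed.

Hypothesis reg : regular_distr.

Lemma rearr_gt s t : (0 <= s)%R -> (s%:E < rearr D mu f t) = (t%:E < distr D mu f s).
Proof.
have [_ mono rc] := reg; move=> s0; apply/idP/idP => [|td].
  (* The infimum defining [rearr] runs over positive levels; testing [s + e] also covers s = 0. *)
  apply: contraTT; rewrite -!leNgt => dt; apply/lee_addgt0Pr => e e0.
  apply: ereal_inf_lbound; exists (s + e)%R => //; split; first by lra.
  by apply: le_trans dt; apply: mono; lra.
have [s' ss' td'] := rc _ _ td.
apply: (@lt_le_trans _ _ s'%:E); first by rewrite lte_fin.
apply: le_ereal_inf_tmp => _ [r [r0 dr] <-]; rewrite lee_fin leNgt; apply/negP => rs'.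
have := le_lt_trans (le_trans (mono _ _ (ltW rs')) dr) td'.
by rewrite ltxx.
Qed.

Lemma rearr_le s t : (0 <= s)%R -> (rearr D mu f t <= s%:E) = (distr D mu f s <= t%:E).
Proof. by move=> s0; rewrite !leNgt rearr_gt. Qed.

Lemma oo_rearr_gt (c : \bar R) s : (0 <= s)%R ->
  oo 0 c `&` [set t | s%:E < rearr D mu f t] = oo 0 (mine c (distr D mu f s)).
Proof.
move=> s0; apply/seteqP; split=> t; rewrite /oo /= rearr_gt// lt_min.
  by move=> [/andP[-> ->] ->].
by move=> /and3P[-> -> ->].
Qed.

Lemma leb_rearr_gt (c : \bar R) s : (0 <= s)%R -> 0 <= c ->
  \int[leb]_(t in oo 0 c `&` [set t |
    s%:E < rearr D mu f t]) 1%:E = mine c (distr D mu f s).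
Proof.
have [d0 _ _] := reg; move=> s0 c0; rewrite oo_rearr_gt// integral_cst;
  last exact: measurable_oo.
by rewrite mul1e; apply: leb_oo0; rewrite le_min c0/=.
Qed.

Lemma measurable_rearr (c : \bar R) :
  measurable_fun (oo 0 c : set (Leb R)) (fun t : Leb R => rearr D mu f t).
Proof.
apply: noninc_measurable; first exact: is_interval_oo.
by move=> x y _ _; exact: rearr_noninc.
Qed.

End Galois.

Lemma eq_rearr (D D' : set R) mu mu' (f f' : R -> R) :
  (forall s, (0 < s)%R -> distr D mu f s = distr D' mu' f' s) ->
  rearr D mu f = rearr D' mu' f'.
Proof.
move=> H; apply/funext => t; rewrite /rearr; congr ereal_inf.
apply/seteqP; split=> _ [s [s0 ds] <-]; exists s => //; split=> //.
  by rewrite -H.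
by rewrite H.
Qed.

(** The superlevel set at [s] is the initial interval of length [distr D mu f s], which fits into
    (0, c). Applied to f^{*,w} on J, it shows that this function is its own rearrangement. *)
Lemma distr_rearr (D : set R) mu (f : R -> R) (c : \bar R) : regular_distr D mu f ->
  (forall s, distr D mu f s <= c) -> (forall t, oo 0 c t -> rearr D mu f t < +oo) ->
  forall s, (0 < s)%R -> distr (oo 0 c) leb (fine \o rearr D mu f) s = distr D mu f s.
Proof.
move=> reg dc fin s s0; have [d0 _ _] := reg.
rewrite /distr [X in leb X](_ : _ = oo 0 (distr D mu f s)).
  exact: leb_oo0.
apply/seteqP; split=> t /=.
  move=> [ct]; rewrite ger0_norm ?fine_ge0 ?rearr_ge0//.
  rewrite -lte_fin fineK ?ge0_fin_numE ?rearr_ge0 ?fin// rearr_gt ?(ltW s0)//.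
  by rewrite /oo /=; case/andP: ct => -> _ ->.
move=> /andP[t0 td].
have ct : oo 0 c t by rewrite /oo /= t0 (lt_le_trans td).
split=> //; rewrite ger0_norm ?fine_ge0 ?rearr_ge0//.
by rewrite -lte_fin fineK ?ge0_fin_numE ?rearr_ge0 ?fin// rearr_gt ?(ltW s0).
Qed.

(** * Hardy-Littlewood inequalities for a measure with density, covering both m and w dm *)

Section Mass.
Variables (D : set R) (v : R -> R) (mu : set R -> \bar R) (f : R -> R).
Hypothesis mD : measurable (D : set (Leb R)).
Hypothesis mv : measurable_fun (D : set (Leb R)) (v : Leb R -> R).
Hypothesis v0 : forall x, D x -> (0 <= v x)%R.
Hypothesis mf : measurable_fun (D : set (Leb R)) (f : Leb R -> R).
Hypothesis muE : forall s, distr D mu f s = \int[leb]_(x in D `&` [set x | (s < `|f x|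
  )%R]) (v x)%:E.

Lemma measurable_abs (A : set R) : measurable (A : set (Leb R)) -> A `<=` D ->
  measurable_fun (A : set (Leb R)) (fun x : Leb R => (`|f x|)%:E).
Proof.
move=> mA AD; apply/(measurable_EFinP (T := Leb R)).
apply: (measurableT_comp (@measurable_realfun.normr_measurable R setT)).
exact: (@measurable_funS _ _ (Leb R) _ D).
Qed.

Lemma measurable_gt (A : set R) s : measurable (A : set (Leb R)) -> A `<=` D ->
  measurable (A `&` [set x | (s < `|f x|)%R] : set (Leb R)).
Proof.
move=> mA AD.
move: (measurable_abs mA AD) => /(measurable_realfun.emeasurable_fun_o_infty mA) /(_ s%:E).
by congr measurable; apply/seteqP; split=> x /=; rewrite lte_fin.
Qed.

Lemma measurable_EFin_weight (A : set R) : A `<=` D ->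
  measurable (A : set (Leb R)) ->
  measurable_fun (A : set (Leb R)) (fun x : Leb R => (v x)%:E).
Proof.
move=> AD mA; apply/(measurable_EFinP (T := Leb R)).
exact: (@measurable_funS _ _ (Leb R) _ D).
Qed.

(** Right continuity is monotone convergence along the sets where |f| > s + 1/n. *)
Lemma regular_mass : regular_distr D mu f.
Proof.
split=> [s|s s' ss'|s t].
- by rewrite muE; apply: integral_ge0 => x [/v0]; rewrite lee_fin.
- rewrite !muE; apply: ge0_subset_integral.
  + exact: measurable_gt.
  + exact: measurable_gt.
  + by apply: measurable_EFin_weight => //; exact: measurable_gt.
  + by move=> x [/v0]; rewrite lee_fin.
  + by move=> x /= [Dx sx]; split=> //; exact: le_lt_trans sx.
pose F n : set (Leb R) := D `&` [set x | (s + n.+1%:R^-1 < `|f x|)%R].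
have Fnd : {homo F : n m / (n <= m)%N >-> (n <= m)%O}.
  move=> n m nm; apply/subsetPset => x /= [Dx sx]; split=> //.
  by apply: le_lt_trans sx; rewrite lerD2l lef_pV2 ?posrE// ler_nat.
have FU : \bigcup_n F n = D `&` [set x | (s < `|f x|)%R].
  apply/seteqP; split=> x /=.
    move=> [n _ [Dx h]]; split=> //; apply: le_lt_trans h.
    by rewrite lerDl invr_ge0.
  move=> [Dx h]; have e0 : (0 < `|f x| - s)%R by rewrite subr_gt0.
  have [n nh] : exists n : nat, (n.+1%:R^-1 < `|f x| - s)%R.
    exists (Num.truncn (`|f x| - s)^-1).
    by rewrite invf_plt ?posrE//; exact: truncnS_gt.
  by exists n => //; split=> //=; rewrite -ltrBrDl.
have mF n : measurable (F n) by exact: measurable_gt.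
have cv := @ge0_nondecreasing_set_cvg_integral _ (Leb R) R F (fun x => (v x)%:E) leb Fnd mF
  (fun n => measurable_EFin_weight (@subIsetl _ _ _) (mF n)) (fun n x h => v0 h.1).
have nd := @ge0_nondecreasing_set_nondecreasing_integral _ (Leb R) R F (fun x => (v
  x)%:E) leb Fnd mF
  (fun n => measurable_EFin_weight (@subIsetl _ _ _) (mF n)) (fun n x h => v0 h.1).
have cv' := ereal_nondecreasing_cvgn nd.
rewrite muE -FU (cvg_unique _ cv cv')// => /ereal_sup_gt[_ [n _ <-] tn].
exists (s + n.+1%:R^-1)%R; first by rewrite ltrDl invr_gt0.
by rewrite muE.
Qed.

(** At each level the part of [A] above it has mass at most the minimum of the mass of [A] and of
    the distribution function, and this minimum is the length of the matching superlevel set on the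
    right. *)
Lemma hardy_littlewood (A : set R) : measurable (A : set (Leb R)) -> A `<=` D ->
  \int[leb]_(x in A) ((v x)%:E * (`|f x|)%:E) <=
  \int[leb]_(t in oo 0 (\int[leb]_(x in A) (v x)%:E)) rearr D mu f t.
Proof.
move=> mA AD; set m := \int[leb]_(x in A) (v x)%:E.
have m0 : 0 <= m by apply: integral_ge0 => x /AD /v0; rewrite lee_fin.
under [leRHS]eq_integral do rewrite -[rearr _ _ _ _]mul1e.
apply: (@le_integral_distr R A (oo 0 m) v (cst 1%R)).
- exact: mA.
- exact: measurable_oo.
- exact: (@measurable_funS _ _ (Leb R) _ D).
- by move=> x /AD /v0.
- exact: measurable_cst.
- by [].
- exact: measurable_abs.
- by [].
- exact: measurable_rearr.
- by move=> x _; exact: rearr_ge0.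
move=> s s0; rewrite leb_rearr_gt ?(ltW s0)//; last exact: regular_mass.
have mAs := measurable_gt s mA AD.
rewrite le_min; apply/andP; split.
  apply: ge0_subset_integral.
  - exact: mAs.
  - exact: mA.
  - exact: measurable_EFin_weight.
  - by move=> x /AD /v0; rewrite lee_fin.
  - by move=> x [].
rewrite muE; apply: ge0_subset_integral.
- exact: mAs.
- exact: measurable_gt.
- by apply: measurable_EFin_weight; [exact: subIsetl|exact: measurable_gt].
- by move=> x [/v0]; rewrite lee_fin.
- by move=> x /= [/AD].
Qed.

(** The equality case: if [A] is nested with every superlevel set, the minimum of the two masses is
    attained. *)
Lemma hardy_littlewood_initial (A : set R) : measurable (A : set (Leb R)) -> A `<=` D ->
  (forall s, (0 < s)%R -> A `<=` [set x | (s < `|f x|)%R] \/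
     D `&` [set x | (s < `|f x|)%R] `<=` A) ->
  \int[leb]_(t in oo 0 (\int[leb]_(x in A) (v x)%:E)) rearr D mu f t <=
  \int[leb]_(x in A) ((v x)%:E * (`|f x|)%:E).
Proof.
move=> mA AD Ainit; set m := \int[leb]_(x in A) (v x)%:E.
have m0 : 0 <= m by apply: integral_ge0 => x /AD /v0; rewrite lee_fin.
under [leLHS]eq_integral do rewrite -[rearr _ _ _ _]mul1e.
apply: (@le_integral_distr R (oo 0 m) A (cst 1%R) v).
- exact: measurable_oo.
- exact: mA.
- exact: measurable_cst.
- by [].
- exact: (@measurable_funS _ _ (Leb R) _ D).
- by move=> x /AD /v0.
- exact: measurable_rearr.
- by move=> x _; exact: rearr_ge0.
- exact: measurable_abs.
- by [].
move=> s s0; rewrite leb_rearr_gt ?(ltW s0)//; last exact: regular_mass.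
rewrite ge_min; apply/orP; have [As|As] := Ainit _ s0; [left|right].
  suff -> : A `&` [set x | s%:E < (`|f x|)%:E] = A by [].
  by apply/seteqP; split=> x //= Ax; [case: Ax|split=> //; rewrite lte_fin; exact: As].
rewrite muE; suff -> : A `&` [set x | s%:E < (`|f x|)%:E]
  = D `&` [set x | (s < `|f x|)%R] by [].
apply/seteqP; split=> x /=; rewrite lte_fin => -[h1 h2]; split=> //; first exact: AD.
by apply: As.
Qed.

End Mass.

End Rearrangement.

(** * Primitives of decreasing functions *)

Section Primitive.
Context {R : realType}.
Notation leb := (@completed_lebesgue_measure R).
Variables (a : \bar R) (h : R -> \bar R).
Hypothesis a0 : 0 < a.
Hypothesis h_ge0 : forall x, I_a a x -> 0 <= h x.
Hypothesis h_ni : forall x y, I_a a x -> I_a a y -> (x <= y)%R -> h y <= h x.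
Hypothesis h_fin : forall x, I_a a x -> \int[leb]_(t in oo 0 x%:E) h t < +oo.

Definition prim (x : R) : R := fine (\int[leb]_(t in oo 0 x%:E) h t).

Lemma oo_sub_I (x : R) (y : \bar R) : (0 <= x)%R -> y <= a -> oo x y `<=` I_a a.
Proof.
move=> x0 ya t; rewrite /I_a /oo /= => /andP[xt ty].
by rewrite (lt_le_trans ty ya) (le_lt_trans _ xt)// lee_fin.
Qed.

Lemma measurable_h (x : R) (y : \bar R) : (0 <= x)%R -> y <= a ->
  measurable_fun (oo x y : set (Leb R)) (fun t : Leb R => h t).
Proof.
move=> x0 ya; apply: noninc_measurable; first exact: is_interval_oo.
by move=> s t /(oo_sub_I x0 ya) sI /(oo_sub_I x0 ya) tI; exact: h_ni.
Qed.

Lemma int_ge0 (x : R) (y : \bar R) : (0 <= x)%R -> y <= a ->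
  0 <= \int[leb]_(t in oo x y) h t.
Proof. by move=> x0 ya; apply: integral_ge0 => t /(oo_sub_I x0 ya); exact: h_ge0. Qed.

Lemma oo_empty (x : R) : oo x x%:E = set0.
Proof. by rewrite -subset0 => t /andP[/lt_trans/[apply]]; rewrite ltxx. Qed.

Lemma leb_set1 (x : R) : leb [set x] = 0.
Proof. exact: lebesgue_measure_set1. Qed.

Lemma int_split (x : R) (y : \bar R) : (0 <= x)%R -> x%:E < y -> y <= a ->
  \int[leb]_(t in oo 0 y) h t = \int[leb]_(t in oo 0 x%:E) h t + \int[leb]_(t in oo x y)
    h t.
Proof.
move=> x0 xy ya.
have mx : measurable ([set x] : set (Leb R)) by apply: sub_caratheodory.
have xa : x%:E <= a by apply: ltW; apply: lt_le_trans ya.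
rewrite (@ge0_negligible_integral _ _ _ leb (oo 0 y) [set x]); last 1 first.
- exact: leb_set1.
- have -> : oo 0 y `\` [set x] = oo 0 x%:E `|` oo x y.
    apply/seteqP; split=> t; rewrite /oo /= !lte_fin.
      move=> [/andP[t0 ty] /eqP]; rewrite t0 ty andbT/= neq_lt => /orP[->|->];
        [by left|by right].
    move=> [/andP[t0 tx]|/andP[xt ty]].
      by rewrite t0 (lt_trans _ xy) ?lte_fin//; split=> // E; move: tx; rewrite E ltxx.
    by rewrite ty (le_lt_trans x0 xt); split=> // E; move: xt; rewrite E ltxx.
  apply: ge0_integral_setU.
  + exact: measurable_oo.
  + exact: measurable_oo.
  + apply/measurable_funU; [exact: measurable_oo|exact: measurable_oo|].
    by split; apply: measurable_h.
  + move=> t [|]; first by move=> /(oo_sub_I (lexx _) xa); exact: h_ge0.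
    by move=> /(oo_sub_I x0 ya); exact: h_ge0.
  + apply/disj_setPS => t [/andP[_ tx] /andP[xt _]].
    by move: (lt_trans tx xt); rewrite ltxx.
- exact: mx.
- exact: measurable_oo.
- exact: measurable_h.
- by move=> t /(oo_sub_I (lexx _) ya); exact: h_ge0.
Qed.

Lemma int_le_cst (x : R) (y : R) : (0 < x)%R -> (x <= y)%R -> x%:E < a -> y%:E <= a ->
  \int[leb]_(t in oo x y%:E) h t <= h x * (y - x)%:E.
Proof.
move=> x0 xy xa ya; have xI : I_a a x by rewrite /I_a /oo /= lte_fin x0.
have -> : h x * (y - x)%:E = \int[leb]_(t in oo x y%:E) cst (h x) t.
  rewrite integral_cst; last exact: measurable_oo.
  congr (_ * _); apply/esym; rewrite EFinB; apply: leb_oo; rewrite lee_fin//.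
apply: ge0_le_integral; [exact: measurable_oo| | | |].
- by move=> t /(oo_sub_I (ltW x0) ya); exact: h_ge0.
- by apply: measurable_h => //; exact: ltW.
- exact: measurable_cst.
- move=> t tx; apply: h_ni => //; first exact: (oo_sub_I (ltW x0) ya).
  by case/andP: tx; rewrite lte_fin => /ltW.
Qed.

Lemma int_ge_cst (x : R) (y : R) : (0 <= x)%R -> (x <= y)%R -> I_a a y ->
  h y * (y - x)%:E <= \int[leb]_(t in oo x y%:E) h t.
Proof.
move=> x0 xy yI; have ya : y%:E <= a by case/andP: yI => _ /ltW.
have -> : h y * (y - x)%:E = \int[leb]_(t in oo x y%:E) cst (h y) t.
  rewrite integral_cst; last exact: measurable_oo.
  congr (_ * _); apply/esym; rewrite EFinB; apply: leb_oo; rewrite lee_fin//.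
apply: ge0_le_integral; [exact: measurable_oo| | | |].
- by move=> t _; exact: h_ge0.
- exact: measurable_cst.
- by apply: measurable_h.
- move=> t tx; apply: h_ni => //; first exact: (oo_sub_I x0 ya).
  by case/andP: tx => _; rewrite lte_fin => /ltW.
Qed.

Lemma h_lty x : I_a a x -> h x < +oo.
Proof.
move=> xI; have x0 : (0 < x)%R by case/andP: xI.
have := le_lt_trans (int_ge_cst (lexx 0%R) (ltW x0) xI) (h_fin xI).
rewrite subr0; case E : (h x) => [r| |] //; first by move=> _; rewrite ltry.
by rewrite gt0_mulye ?lte_fin.
Qed.

Lemma h_fineK x : I_a a x -> (fine (h x))%:E = h x.
Proof. by move=> xI; rewrite fineK// ge0_fin_numE ?h_lty// h_ge0. Qed.

Lemma primE x : (0 <= x)%R -> x%:E <= a -> \int[leb]_(t in oo 0 x%:E) h t = (prim x)%:E.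
Proof.
rewrite le_eqVlt => /orP[/eqP <- _|x0 xa].
  by rewrite /prim oo_empty integral_set0.
rewrite /prim fineK// ge0_fin_numE; last exact: int_ge0.
(* Here [x] may be the finite endpoint [a], which [h_fin] does not cover; past x/2 the integrand is
   bounded by its value at x/2. *)
have x2 : (0 < x / 2)%R by lra.
have xx : ((x / 2)%:E < x%:E) by rewrite lte_fin; lra.
have xI : I_a a (x / 2)%R by rewrite /I_a /oo /= lte_fin x2 (lt_le_trans xx).
rewrite (int_split (ltW x2) xx xa); apply: lte_add_pinfty; first exact: h_fin.
apply: le_lt_trans (int_le_cst x2 (ltW xx) (lt_le_trans xx xa) xa) _.
by rewrite -h_fineK// -EFinM ltry.
Qed.

Lemma prim_sub x y : (0 <= x)%R -> (x <= y)%R -> y%:E <= a ->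
  \int[leb]_(t in oo x y%:E) h t = (prim y - prim x)%:E.
Proof.
move=> x0; rewrite le_eqVlt => /orP[/eqP <- _|xy ya].
  by rewrite oo_empty integral_set0 subrr.
have xa : x%:E <= a by apply: le_trans ya; rewrite lee_fin ltW.
have := int_split x0 (_ : x%:E < y%:E) ya; rewrite lte_fin => /(_ xy).
rewrite (primE _ ya) ?(le_trans x0 (ltW xy))// (primE x0 xa).
have := int_ge0 x0 ya; case: (\int[leb]_(t in oo x y%:E) h t) => [r| |] //= _ [->].
by congr EFin; ring.
Qed.

Lemma prim0 : prim 0 = 0%R.
Proof. by rewrite /prim oo_empty integral_set0. Qed.

Lemma prim_le x y : (0 <= x)%R -> (x <= y)%R -> y%:E <= a -> (prim x <= prim y)%R.
Proof.
move=> x0 xy ya; rewrite -subr_ge0 -lee_fin -prim_sub//; exact: int_ge0.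
Qed.

Lemma prim_ub x y : (0 < x)%R -> (x <= y)%R -> x%:E < a -> y%:E <= a ->
  (prim y - prim x <= fine (h x) * (y - x))%R.
Proof.
move=> x0 xy xa ya; rewrite -lee_fin -(prim_sub (ltW x0) xy ya) EFinM h_fineK;
  first exact: int_le_cst.
by rewrite /I_a /oo /= lte_fin x0.
Qed.

Lemma prim_lb x y : (0 <= x)%R -> (x <= y)%R -> I_a a y ->
  (fine (h y) * (y - x) <= prim y - prim x)%R.
Proof.
move=> x0 xy yI; have ya : y%:E <= a by case/andP: yI => _ /ltW.
rewrite -lee_fin -(prim_sub x0 xy ya).
by rewrite EFinM h_fineK//; exact: int_ge_cst.
Qed.

Lemma exists_in_I : exists2 x : R, (0 < x)%R & x%:E < a.
Proof.
case: a a0 => [r| |] //; last by exists 1%R; rewrite ?ltry.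
by rewrite lte_fin => r0; exists (r / 2)%R; rewrite ?lte_fin; lra.
Qed.

(** If the primitive stayed at or above [e] near 0, all integrals over (p, x) would be at most
    [prim x - e], hence so would the one over (0, x). *)
Lemma prim_cont0 e : (0 < e)%R -> exists2 d : R, (0 < d)%R &
  forall x, (0 <= x)%R -> (x < d)%R -> x%:E <= a -> (prim x < e)%R.
Proof.
move=> e0; have [x x0 xa] := exists_in_I.
have [[p [p0 px pe]]|nex] := pselect (exists p, [/\ (0 < p)%R,
  (p <= x)%R & (prim p < e)%R]).
  exists p => // y y0 yp ya; apply: le_lt_trans pe; apply: prim_le => //; first exact: ltW.
  by apply: le_trans (ltW xa); rewrite lee_fin.
have : \int[leb]_(t in oo 0 x%:E) h t <= (prim x - e)%:E.
  apply: int_oo0_le => //.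
  - by apply: measurable_h => //; exact: ltW.
  - by move=> t /(oo_sub_I (lexx _) (ltW xa)); exact: h_ge0.
  move=> p p0 px; rewrite (prim_sub (ltW p0) px (ltW xa)) lee_fin lerD2l lerN2.
  by rewrite leNgt; apply/negP => pe; apply: nex; exists p.
by rewrite (primE (ltW x0) (ltW xa)) lee_fin; lra.
Qed.

(* Lipschitz away from 0. *)
Lemma prim_cont_pos b e : (0 < b)%R -> b%:E <= a -> (0 < e)%R -> exists2 d : R, (0 < d)%R &
  forall x, (0 <= x)%R -> x%:E <= a -> (`|x - b| < d)%R -> (`|prim x - prim b| < e)%R.
Proof.
move=> b0 ba e0; pose c := (b / 2)%R.
have c0 : (0 < c)%R by rewrite /c; lra.
have cb : (c < b)%R by rewrite /c; lra.
have ca : c%:E < a by apply: lt_le_trans ba; rewrite lte_fin.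
have cI : I_a a c by rewrite /I_a /oo /= lte_fin c0.
(* The summand 1 keeps the Lipschitz constant positive when [h] vanishes at [c]. *)
pose L := (fine (h c) + 1)%R.
have hc0 : (0 <= fine (h c))%R by apply: fine_ge0; exact: h_ge0.
have L0 : (0 < L)%R by rewrite /L; lra.
have Lip x y : (c <= x)%R -> (x <= y)%R -> y%:E <= a -> (prim y - prim x <= L * (y - x))%R.
  move=> cx; rewrite le_eqVlt => /orP[/eqP -> _|xy ya]; first by rewrite !subrr mulr0.
  have xa : x%:E < a by apply: lt_le_trans ya; rewrite lte_fin.
  have x0 : (0 < x)%R by lra.
  have xI : I_a a x by rewrite /I_a /oo /= lte_fin x0.
  apply: le_trans (prim_ub x0 (ltW xy) xa ya) _.
  rewrite ler_pM2r ?subr_gt0// /L.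
  have : (fine (h x) <= fine (h c))%R by rewrite -lee_fin !h_fineK//; exact: h_ni.
  by lra.
exists (Num.min (b - c) (e / L))%R; first by rewrite lt_min subr_gt0 cb divr_gt0.
move=> x x0 xa; rewrite lt_min => /andP[xb1 xb2].
have cx : (c <= x)%R by move: xb1; rewrite ltr_norml; lra.
rewrite ltr_pdivlMr// mulrC in xb2.
have [xb|bx] := leP x b.
  rewrite distrC ger0_norm; last by rewrite subr_ge0 prim_le.
  apply: le_lt_trans (Lip _ _ cx xb ba) _.
  by rewrite distrC ger0_norm ?subr_ge0// in xb2.
rewrite ger0_norm; last by rewrite subr_ge0 prim_le// ltW.
apply: le_lt_trans (Lip _ _ (ltW cb) (ltW bx) xa) _.
by rewrite ger0_norm ?subr_ge0 ?(ltW bx)// in xb2.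
Qed.

Lemma prim_cont : cont_indom a prim.
Proof.
move=> x e [x0 xa] e0; have [x00|x00] := eqVneq x 0%R.
  have [d d0 H] := prim_cont0 e0; exists d => // y [y0 ya].
  rewrite x00 prim0 !subr0 !ger0_norm//; last by rewrite -prim0 prim_le// ltW.
  by move=> /H; apply=> //; exact: ltW.
have x0' : (0 < x)%R by rewrite lt_neqAle eq_sym x00.
have [d d0 H] := prim_cont_pos x0' (ltW xa) e0; exists d => // y [y0 ya] yx.
by apply: H => //; exact: ltW.
Qed.

(** Continuity at a finite endpoint, monotone convergence along (0, n) otherwise. For h = w this is
    half of the surjectivity of W onto J. *)
Lemma prim_unbounded (u : R) : (0 <= u)%R -> u%:E < \int[leb]_(t in I_a a) h t ->
  exists2 x, I_a a x & (u < prim x)%R.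
Proof.
move=> u0; have [[r E]|E] : (exists r, a = r%:E) \/ a = +oo.
- by case: a a0 => [r| |] // _; [left; exists r|right].
- have r0 : (0 < r)%R by move: a0; rewrite E lte_fin.
  have ra : r%:E <= a by rewrite E.
  rewrite /I_a [X in oo 0 X]E primE// ?ltW// lte_fin => ur.
  have e0 : (0 < prim r - u)%R by lra.
  have [d d0 H] := prim_cont_pos r0 ra e0.
  pose m := Num.min (r / 2)%R (d / 2)%R.
  have m1 : (m <= r / 2)%R by rewrite ge_min lexx.
  have m2 : (m <= d / 2)%R by rewrite ge_min lexx orbT.
  have m0 : (0 < m)%R by rewrite lt_min; apply/andP; split; lra.
  have xr : (r - m < r)%R by lra.
  exists (r - m)%R; first by rewrite /oo /= !lte_fin xr andbT; lra.
  have := H (r - m)%R; rewrite E lee_fin => /(_ ltac:(lra) ltac:(lra)).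
  rewrite addrAC subrr sub0r normrN ger0_norm ?ltW// => /(_ ltac:(lra)).
  by rewrite ltr_norml; lra.
pose G n : set (Leb R) := oo 0 (n%:R%:E).
have Gnd : {homo G : n m / (n <= m)%N >-> (n <= m)%O}.
  move=> n m nm; apply/subsetPset => t; rewrite /G /oo /= => /andP[-> h1] /=.
  by apply: lt_le_trans h1 _; rewrite lee_fin ler_nat.
have GU : \bigcup_n G n = I_a a.
  apply/seteqP; split=> t; rewrite /G /I_a E /oo /=.
    by move=> [n _ /andP[-> _]]; rewrite ltry.
  move=> /andP[t0 _]; exists (Num.truncn t).+1 => //=.
  by rewrite t0 lte_fin; exact: truncnS_gt.
have na n : n%:R%:E <= a :> \bar R by rewrite E leey.
have mG n : measurable (G n) by exact: measurable_oo.
have mhG n : measurable_fun (G n) (fun t : Leb R => h t) by exact: measurable_h.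
have hG n (t : Leb R) : G n t -> 0 <= h t.
  by move=> /(oo_sub_I (lexx _) (na n)); exact: h_ge0.
have cv := @ge0_nondecreasing_set_cvg_integral _ (Leb R) R G h leb Gnd mG mhG hG.
have nd := @ge0_nondecreasing_set_nondecreasing_integral _ (Leb R) R G h leb Gnd mG mhG hG.
have cv' := ereal_nondecreasing_cvgn nd.
have := cvg_unique _ cv cv'; rewrite GU => /(_ (@ereal_hausdorff R)) ->
  /ereal_sup_gt[_ [n _ <-]].
rewrite /G primE// lte_fin => un; exists n%:R%R => //.
rewrite /I_a /oo /= E ltry andbT lte_fin ltr0n lt0n; apply/negP => /eqP n0.
by move: un; rewrite n0 prim0; lra.
Qed.

End Primitive.

(** * Statements holding almost everywhere *)

Section AlmostEverywhere.
Context {R : realType}.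
Notation leb := (@completed_lebesgue_measure R).
Implicit Types (D : set R) (P Q S : R -> Prop).

Lemma ae_on_sub D P (A : set R) : leb.-negligible (A : set (Leb R)) ->
  (forall x, D x -> ~ A x -> P x) -> ae_on D P.
Proof.
move=> [B [mB B0 AB]] H; exists B; split=> // x /= nP; apply: AB.
by apply: contrapT => nA; apply: nP => Dx; exact: H.
Qed.

Lemma ae_on2 D P Q S : ae_on D P -> ae_on D Q ->
  (forall x, D x -> P x -> Q x -> S x) -> ae_on D S.
Proof.
move=> hP hQ H; apply: (ae_on_sub (negligibleU hP hQ)) => x Dx /not_orP[/contrapT p
  /contrapT q].
by apply: H => //; [exact: p|exact: q].
Qed.

Lemma ae_on1 D P Q : ae_on D P -> (forall x, D x -> P x -> Q x) -> ae_on D Q.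
Proof. by move=> hP H; apply: (ae_on2 hP hP) => x Dx p _; exact: H. Qed.

End AlmostEverywhere.

(** * Integrals of the rearrangement of a sum *)

Section SumBound.
Context {R : realType}.
Notation leb := (@completed_lebesgue_measure R).

Lemma distr_lebE (D : set R) (f : R -> R) s : measurable (D : set (Leb R)) -> L0 D f ->
  distr D leb f s = \int[leb]_(x in D `&` [set x | (s < `|f x|)%R]) (cst 1%R x)%:E.
Proof.
move=> mD mf; have mDs : measurable (D `&` [set x | (s < `|f x|)%R] : set (Leb R)).
  exact: measurable_gt.
by rewrite [RHS](integral_cst leb mDs 1%:E) mul1e.
Qed.

Lemma regular_decr (D : set R) (f : R -> R) : measurable (D : set (Leb R)) -> L0 D f ->
  regular_distr D leb f.
Proof.
move=> mD mf; apply: (@regular_mass R D (cst 1%R)) => //.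
by move=> s; exact: distr_lebE.
Qed.

Lemma max_gt (l s t : R) : (0 < s)%R -> (s < Num.max 0 (t - l))%R = (s + l < t)%R.
Proof. by move=> s0; rewrite lt_max ltNge (ltW s0)/= ltrBrDr. Qed.

Lemma maxe_gt (l s : R) (t : \bar R) : (0 < s)%R ->
  (s%:E < maxe 0 (t - l%:E)) = ((s + l)%:E < t).
Proof.
move=> s0; rewrite lt_max (_ : (s%:E < 0) = false)/=; last first.
  by rewrite lte_fin; apply/negbTE; rewrite -leNgt ltW.
by case: t => [t| |] //=; rewrite ?ltry// -EFinB !lte_fin ltrBrDr.
Qed.

Lemma measurable_excess (c : \bar R) (D : set R) (f : R -> R) (l : R) :
  measurable_fun (oo 0 c : set (Leb R)) (fun t : Leb R => maxe 0 (decr D f t - l%:E)).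
Proof.
apply: noninc_measurable; first exact: is_interval_oo.
move=> x y _ _ xy; rewrite ge_max le_max lexx/= le_max leeD2r ?orbT//.
exact: rearr_noninc.
Qed.

Lemma measurable_excess_fun (D : set R) (f : R ->
  R) (l : R) : measurable (D : set (Leb R)) -> L0 D f ->
  measurable_fun (D : set (Leb R)) (fun x : Leb R => (Num.max 0 (`|f x| - l))%:E).
Proof.
move=> mD mf; apply/(measurable_EFinP (T := Leb R)).
apply: measurable_maxr; first exact: measurable_cst.
apply: measurable_funB; last exact: measurable_cst.
exact: (measurableT_comp (@measurable_realfun.normr_measurable R setT)).
Qed.

Lemma int_decr_excess_le (D : set R) (f : R -> R) (l : R) (c : \bar R) :
  measurable (D : set (Leb R)) -> L0 D f -> (0 <= l)%R -> 0 <= c ->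
  \int[leb]_(t in oo 0 c) maxe 0 (decr D f t - l%:E) <=
  \int[leb]_(x in D) (Num.max 0 (`|f x| - l))%:E.
Proof.
move=> mD mf l0 c0; have reg := regular_decr mD mf.
under [leLHS]eq_integral do rewrite -[maxe _ _]mul1e.
under [leRHS]eq_integral do rewrite -[_%:E]mul1e.
apply: (@le_integral_distr R (oo 0 c) D (cst 1%R) (cst 1%R)).
- exact: measurable_oo.
- exact: mD.
- exact: measurable_cst.
- by [].
- exact: measurable_cst.
- by [].
- exact: measurable_excess.
- by move=> x _; rewrite le_max lexx.
- exact: measurable_excess_fun.
- by move=> x _; rewrite lee_fin le_max lexx.
move=> s s0; have sl : (0 <= s + l)%R by lra.
have -> : [set x | s%:E < maxe 0 (decr D f x - l%:E)] = [set x | (s + l)%:E < decr D f x].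
  by apply/seteqP; split=> x /=; rewrite maxe_gt.
have -> : [set x | s%:E < (Num.max 0 (`|f x| - l))%:E] = [set x | (s + l < `|f x|)%R].
  by apply/seteqP; split=> x /=; rewrite lte_fin max_gt.
by rewrite leb_rearr_gt// -distr_lebE// ge_min lexx orbT.
Qed.

(** The condition f^*(x) <= l says that |f| exceeds [l] on a set of measure at most [x], so cutting
    the rearrangement at [x] loses nothing of the excess. *)
Lemma int_excess_le_decr (D : set R) (f : R -> R) (l x : R) :
  measurable (D : set (Leb R)) -> L0 D f -> (0 <= l)%R -> (0 <= x)%R ->
    decr D f x <= l%:E ->
  \int[leb]_(x in D) (Num.max 0 (`|f x| - l))%:E <=
  \int[leb]_(t in oo 0 x%:E) maxe 0 (decr D f t - l%:E).
Proof.
move=> mD mf l0 x0 xl; have reg := regular_decr mD mf; have [_ mono _] := reg.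
under [leRHS]eq_integral do rewrite -[maxe _ _]mul1e.
under [leLHS]eq_integral do rewrite -[_%:E]mul1e.
apply: (@le_integral_distr R D (oo 0 x%:E) (cst 1%R) (cst 1%R)).
- exact: mD.
- exact: measurable_oo.
- exact: measurable_cst.
- by [].
- exact: measurable_cst.
- by [].
- exact: measurable_excess_fun.
- by move=> y _; rewrite lee_fin le_max lexx.
- exact: measurable_excess.
- by move=> y _; rewrite le_max lexx.
move=> s s0; have sl : (0 <= s + l)%R by lra.
have -> : [set x | s%:E < maxe 0 (decr D f x - l%:E)] = [set x | (s + l)%:E < decr D f x].
  by apply/seteqP; split=> y /=; rewrite maxe_gt.
have -> : [set x | s%:E < (Num.max 0 (`|f x| - l))%:E] = [set x | (s + l < `|f x|)%R].
  by apply/seteqP; split=> y /=; rewrite lte_fin max_gt.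
rewrite leb_rearr_gt ?lee_fin// -distr_lebE// le_min lexx andbT.
apply: (@le_trans _ _ (distr D leb f l)); first by apply: mono; lra.
by rewrite -rearr_le.
Qed.

(** Cut at the level l = h^*(x). The excess of |f| over [l] is at most |g| plus the excess of |h|;
    one copy of the integral of h^* pays for this last excess and the other for l x. *)
Lemma int_decr_add_le (D : set R) (f g h : R -> R) (x : R) :
  measurable (D : set (Leb R)) -> L0 D f -> L0 D g -> L0 D h ->
  ae_on D (fun x => f x = (g x + h x)%R) -> (0 < x)%R -> decr D h x < +oo ->
  \int[leb]_(t in oo 0 x%:E) decr D f t <=
  \int[leb]_(x in D) (`|g x|)%:E +
  (\int[leb]_(t in oo 0 x%:E) decr D h t + \int[leb]_(t in oo 0 x%:E) decr D h t).
Proof.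
move=> mD mf mg mh fgh x0 hx.
have x0' : (0%R : \bar R) <= x%:E by rewrite lee_fin ltW.
pose l := fine (decr D h x).
have lE : l%:E = decr D h x by rewrite fineK// ge0_fin_numE// rearr_ge0.
have l0 : (0 <= l)%R by rewrite -lee_fin lE rearr_ge0.
have hoo := @measurable_oo R 0 x%:E.
have le1 : \int[leb]_(t in oo 0 x%:E) decr D f t <=
    l%:E * x%:E + \int[leb]_(t in oo 0 x%:E) maxe 0 (decr D f t - l%:E).
  have -> : l%:E * x%:E = \int[leb]_(t in oo 0 x%:E) cst l%:E t.
    by rewrite integral_cst//; congr (_ * _); apply/esym; exact: leb_oo0.
  rewrite -ge0_integralD; [|exact: hoo|by move=> t _; rewrite lee_fin|exact: measurable_cst|
    by move=> t _; rewrite le_max lexx|exact: measurable_excess].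
  apply: ge0_le_integral; [exact: hoo|by move=> t _;
    exact: rearr_ge0|exact: measurable_rearr| |].
    apply: emeasurable_funD; [exact: measurable_cst|exact: measurable_excess].
  move=> t _ /=; rewrite addeC -leeBlDr// le_max lexx orbT//.
have le2 := int_decr_excess_le mD mf l0 x0'.
have le3 : \int[leb]_(x in D) (Num.max 0 (`|f x| - l))%:E <=
    \int[leb]_(x in D) (`|g x|)%:E + \int[leb]_(x in D) (Num.max 0 (`|h x| - l))%:E.
  have mg' : measurable_fun (D : set (Leb R)) (fun x : Leb R => (`|g x|)%:E).
    exact: measurable_abs.
  rewrite -ge0_integralD; [|exact: mD|by move=> t _; rewrite lee_fin|exact: mg'|
    by move=> t _; rewrite lee_fin le_max lexx|exact: measurable_excess_fun].
  apply: ae_ge0_le_integral.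
  - exact: mD.
  - by move=> t _; rewrite lee_fin le_max lexx.
  - exact: measurable_excess_fun.
  - by move=> t _; rewrite adde_ge0// lee_fin// le_max lexx.
  - by apply: emeasurable_funD; [exact: mg'|exact: measurable_excess_fun].
  - apply: (ae_on1 fgh) => t Dt ft; rewrite -EFinD lee_fin ft.
    have n1 := ler_normD (g t) (h t); have n2 := normr_ge0 (g t).
    rewrite ge_max; apply/andP; split; first by rewrite addr_ge0// le_max lexx.
    have : (`|h t| - l <= Num.max 0 (`|h t| - l))%R by rewrite le_max lexx orbT.
    by lra.
have le4 : \int[leb]_(x in D) (Num.max 0 (`|h x| - l))%:E <=
    \int[leb]_(t in oo 0 x%:E) maxe 0 (decr D h t - l%:E).
  by apply: int_excess_le_decr; rewrite ?lE// ltW.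
have le5 : \int[leb]_(t in oo 0 x%:E) maxe 0 (decr D h t - l%:E) <= \int[leb]_(t in oo 0
  x%:E) decr D h t.
  apply: ge0_le_integral; [exact: hoo|by move=> t _;
    rewrite le_max lexx|exact: measurable_excess|exact: measurable_rearr|].
  move=> t _; rewrite ge_max; apply/andP; split; first exact: rearr_ge0.
  by rewrite geeDl// -EFinN lee_fin oppr_le0.
have le6 : l%:E * x%:E <= \int[leb]_(t in oo 0 x%:E) decr D h t.
  have -> : l%:E * x%:E = \int[leb]_(t in oo 0 x%:E) cst l%:E t.
    by rewrite integral_cst//; congr (_ * _); apply/esym; exact: leb_oo0.
  apply: ge0_le_integral; [exact: hoo|by move=> t _;
    rewrite lee_fin|exact: measurable_cst|exact: measurable_rearr|].
  move=> t /andP[_ tx]; rewrite lE; apply: rearr_noninc.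
  by rewrite lte_fin in tx; exact: ltW.
apply: le_trans le1 _; rewrite addeCA; apply: leeD => //.
apply: le_trans le2 _; apply: le_trans le3 _; apply: leeD => //.
exact: le_trans le4 le5.
Qed.

End SumBound.

(** * Jumps of monotone functions *)

Section Jumps.
Context {R : realType}.
Notation leb := (@completed_lebesgue_measure R).

Lemma countable_leb0 (A : set R) : countable A -> leb.-negligible (A : set (Leb R)).
Proof.
move=> cA; have mA : measurable (A : set (Leb R)).
  apply: sub_caratheodory; exact: countable_measurable.
by exists A; split=> //; exact: countable_lebesgue_measure0.
Qed.

(** Left continuity, expressed through lower bounds of the values to the left. An exceptional point
    has a rational in its jump, and monotonicity lets each rational serve one point only, so the
    exceptions are countable. *)
Lemma ae_left_limit_le (D : set R) (h : R -> \bar R) :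
  (forall x y, D x -> D y -> (x <= y)%R -> h y <= h x) ->
  ae_on D (fun x => forall c, (forall s, D s -> (s < x)%R -> c <= h s) -> c <= h x).
Proof.
move=> hni.
pose J (q : rat) := [set x | D x /\ (h x < (ratr q)%:E /\ forall s, D s -> (s < x)%R ->
  (ratr q)%:E <= h s)].
apply: (@ae_on_sub _ _ _ (\bigcup_(q in [set: rat]) J q)).
  apply: countable_leb0; apply: bigcup_countable => //.
  move=> q _; have [->|/set0P[y Jy]] := eqVneq (J q) set0; first exact: countable0.
  suff -> : J q = [set y] by exact: countable1.
  apply/seteqP; split=> [x Jx|_ -> //].
  move: Jx Jy => [Dx [hx Hx]] [Dy [hy Hy]].
  have [xy|yx|//] := ltgtP x y.
    by have := le_lt_trans (Hy _ Dx xy) hx; rewrite ltxx.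
  by have := le_lt_trans (Hx _ Dy yx) hy; rewrite ltxx.
move=> x Dx nJ c Hc; rewrite leNgt; apply/negP => hc; apply: nJ.
have [q hq qc] : exists2 q : rat, h x < (ratr q)%:E & (ratr q)%:E <= c.
  have [r hr rc] : exists2 r : R, h x < r%:E & r%:E <= c.
    case: (h x) c hc {Hc} => [u| |] [v| |] //=; rewrite ?lte_fin => uv; try by exists v.
      by exists (u + 1)%R; rewrite ?leey// lte_fin ltrDl.
    by exists 0%R; rewrite ?ltNyr ?leey.
  case: (h x) hr => [u| |] //=; rewrite ?lte_fin => hr.
    have [q /andP[uq qr]] := rat_in_itvoo hr.
    exists q; first by rewrite lte_fin.
    by apply: le_trans rc; rewrite lee_fin ltW.
  have r1 : (r - 1 < r)%R by lra.
  have [q /andP[uq qr]] := rat_in_itvoo r1.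
  exists q; first exact: ltNyr.
    by apply: le_trans rc; rewrite lee_fin ltW.
exists q => //; split=> //; split=> // s Ds sx.
exact: le_trans qc (Hc _ Ds sx).
Qed.

End Jumps.

(** * Endpoints of open intervals, and changes on null sets *)

Section OpenIntervals.
Context {R : realType}.

(** Maximality of level intervals is stated for sets and that of [max_rise] for endpoints; this
    translates one into the other. *)
Lemma oo_subP (x x' : R) (y y' : \bar R) : x%:E < y -> oo x y `<=` oo x' y' ->
  (x' <= x)%R /\ y <= y'.
Proof.
move=> xy sub; split.
  rewrite leNgt; apply/negP => xx'.
  have [t xt ty] : exists2 t : R, (x < t)%R & t%:E < mine x'%:E y.
    by apply: exists_between; rewrite lt_min lte_fin xx'.
  move: ty; rewrite lt_min lte_fin => /andP[tx' ty].
  have /sub : oo x y t by rewrite /oo /= lte_fin xt.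
  by move=> /andP[]; rewrite lte_fin => /(lt_trans tx'); rewrite ltxx.
rewrite leNgt; apply/negP => y'y.
have [c cy' [xc cy]] : exists2 c : R, y' <= c%:E & (x <= c)%R /\ c%:E < y.
  case: y' y'y {sub} => [z| |] //= zy.
  - exists (Num.max z x); first by rewrite lee_fin le_max lexx.
    by rewrite le_max lexx orbT; split=> //; rewrite EFin_max gt_max zy.
  - by move: zy; rewrite ltNge leey.
  - by exists x; rewrite ?leNye.
have [t ct ty] := exists_between cy.
have /sub : oo x y t by rewrite /oo /= ty andbT lte_fin (le_lt_trans xc).
by move=> /andP[_ ty']; have := lt_le_trans ty' cy'; rewrite lte_fin => /(lt_trans ct);
  rewrite ltxx.
Qed.

Lemma oo_inj (x x' : R) (y y' : \bar R) : x%:E < y -> x'%:E < y' -> oo x y = oo x' y' ->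
  x = x' /\ y = y'.
Proof.
move=> xy xy' E.
have [h1 h2] := oo_subP xy (subsetW E); have [h3 h4] := oo_subP xy' (subsetW (esym E)).
by split; apply/eqP; rewrite eq_le ?h1 ?h2 ?h3 ?h4.
Qed.

Lemma eq_mass_ae (D : set R) (v f g : R -> R) s : measurable (D : set (Leb R)) ->
  measurable_fun (D : set (Leb R)) (v : Leb R -> R) -> (forall x, D x -> (0 <= v x)%R) ->
  L0 D f -> L0 D g -> ae_on D (fun x => f x = g x) ->
  \int[leb]_(x in D `&` [set x | (s < `|f x|)%R]) (v x)%:E =
  \int[leb]_(x in D `&` [set x | (s < `|g x|)%R]) (v x)%:E.
Proof.
move=> mD mv v0 mf mg [B [mB B0 fg]].
have cut (h : R -> R) : L0 D h -> \int[leb]_(x in D `&` [set x | (s < `|h x|)%R]) (v x)%:E =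
    \int[leb]_(x in (D `&` [set x | (s < `|h x|)%R]) `\` B) (v x)%:E.
  move=> mh; have mDh : measurable (D `&` [set x | (s < `|h x|)%R]
    : set (Leb R)) by exact: measurable_gt.
  apply: ge0_negligible_integral.
  - exact: mB.
  - exact: mDh.
  - by apply: measurable_EFin_weight mDh => //.
  - by move=> x [/v0]; rewrite lee_fin.
  - exact: B0.
rewrite cut// [RHS]cut//; congr (integral _ _ _).
have E x : D x -> ~ B x -> f x = g x.
  by move=> Dx nB; apply: contrapT => n; apply: nB; apply: fg => /= /(_ Dx).
by apply/seteqP; split=> x /= [[Dx h] nB]; split=> //; split=> //; [rewrite -E|rewrite E].
Qed.

(** Rests on the completeness of Lebesgue measure. *)
Lemma L0_ae (D : set R) (f g : R -> R) : L0 D f -> ae_on D (fun x => f x = g x) -> L0 D g.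
Proof.
move=> mf fg; apply/(measurable_EFinP (T := Leb R)).
apply: (@ae_measurable_fun _ (Leb R) R leb completed_lebesgue_measure_is_complete D (EFin
  \o f)).
  by apply: (ae_on1 fg) => x Dx /= ->.
exact/(measurable_EFinP (T := Leb R)).
Qed.

End OpenIntervals.

(** * The level function as the slope of the least majorant *)

Section LevelFunction.
Context {R : realType}.
Notation leb := (@completed_lebesgue_measure R).
Variables (a : \bar R) (w f : R -> R) (C1 C2 : R).
Hypothesis a_gt0 : 0 < a.
Hypothesis w_gt0 : forall t : R, I_a a t -> (0 < w t)%R.
Hypothesis w_decreasing : forall s t : R, I_a a s -> I_a a t -> (s <= t)%R ->
  (w t <= w s)%R.
Hypothesis W_finite : forall t : R, I_a a t -> W w t < +oo.
Hypothesis f_L0 : L0 (I_a a) f.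
Hypothesis C1_ge0 : (0 <= C1)%R.
Hypothesis C2_ge0 : (0 <= C2)%R.
Hypothesis f_bound : forall x, I_a a x ->
  \int[leb]_(t in oo 0 x%:E) decr (I_a a) f t <= C1%:E + C2%:E * W w x.

Let I := I_a a.
Let we (t : R) : \bar R := (w t)%:E.
Let fs := decr I f.
Let V := prim we.
Let F := prim fs.

Lemma we_ge0 x : I x -> 0 <= we x.
Proof. by move=> /w_gt0 /ltW; rewrite lee_fin. Qed.

Lemma we_ni x y : I x -> I y -> (x <= y)%R -> we y <= we x.
Proof. by move=> Ix Iy xy; rewrite lee_fin; exact: w_decreasing. Qed.

Lemma WE x : (0 <= x)%R -> x%:E <= a -> W w x = (V x)%:E.
Proof. by move=> x0 xa; apply: (primE we_ge0 we_ni W_finite). Qed.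

Lemma fs_ge0 x : I x -> 0 <= fs x.
Proof. by move=> _; exact: rearr_ge0. Qed.

Lemma fs_ni x y : I x -> I y -> (x <= y)%R -> fs y <= fs x.
Proof. by move=> _ _; exact: rearr_noninc. Qed.

Lemma fs_fin x : I x -> \int[leb]_(t in oo 0 x%:E) fs t < +oo.
Proof.
move=> Ix; apply: le_lt_trans (f_bound Ix) _.
have /andP[x0 xa] := Ix; rewrite WE ?(ltW xa)//; last by rewrite ltW.
by rewrite -EFinM -EFinD ltry.
Qed.

Lemma in_I x : (0 < x)%R -> x%:E < a -> I x.
Proof. by move=> x0 xa; rewrite /I /I_a /oo /= lte_fin x0. Qed.

Lemma I_indom x : I x -> indom a x.
Proof. by move=> /andP[x0 xa]; split=> //; rewrite -lee_fin ltW. Qed.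

Lemma V_cont : cont_indom a V.
Proof. exact: (prim_cont a_gt0 we_ge0 we_ni W_finite). Qed.

Lemma F_cont : cont_indom a F.
Proof. exact: (prim_cont a_gt0 fs_ge0 fs_ni fs_fin). Qed.

Lemma F_nd x y : indom a x -> indom a y -> (x <= y)%R -> (F x <= F y)%R.
Proof. by move=> [x0 xa] [y0 ya] xy; apply: (prim_le fs_ge0 fs_ni fs_fin) => //;
  exact: ltW. Qed.

Lemma V_incr_le x y : (0 <= x)%R -> (x < y)%R -> y%:E <= a -> (V x < V y)%R.
Proof.
move=> x0 xy ya; pose z := ((x + y) / 2)%R.
have xz : (x < z)%R by rewrite /z; lra.
have zy : (z < y)%R by rewrite /z; lra.
have zI : I z.
  by apply: in_I; [lra|apply: lt_le_trans ya; rewrite lte_fin].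
have h1 := prim_lb we_ge0 we_ni W_finite x0 (ltW xz) zI.
have h2 : (V z <= V y)%R by apply: (prim_le we_ge0 we_ni W_finite) => //; lra.
have : (0 < w z * (z - x))%R by rewrite mulr_gt0 ?subr_gt0// w_gt0.
rewrite /= in h1; rewrite /V in h2 *; lra.
Qed.

Lemma V_incr x y : indom a x -> indom a y -> (x < y)%R -> (V x < V y)%R.
Proof. by move=> [x0 xa] [y0 ya] xy; apply: V_incr_le => //; exact: ltW. Qed.

Lemma V_gt0 x : I x -> (0 < V x)%R.
Proof.
by move=> /andP[x0 xa]; rewrite -(prim0 we); apply: V_incr_le => //; exact: ltW.
Qed.

Lemma F_bound x : indom a x -> (F x <= C1 + C2 * V x)%R.
Proof.
move=> [x0 xa]; have [->|x0'] := eqVneq x 0%R.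
  by rewrite /F /V !prim0 mulr0 addr0.
have Ix : I x by apply: in_I => //; rewrite lt_neqAle eq_sym x0'.
have := f_bound Ix; rewrite WE ?(ltW xa)// (primE fs_ge0 fs_ni fs_fin) ?(ltW xa)//.
Qed.

Definition slope (x y : R) : R := ((F y - F x) / (V y - V x))%R.

Lemma RfinE x y : (0 <= x)%R -> (x < y)%R -> y%:E <= a -> Rfin a w f x y = (slope x y)%:E.
Proof.
move=> x0 xy ya; rewrite /Rfin (prim_sub fs_ge0 fs_ni fs_fin x0 (ltW xy) ya).
rewrite (prim_sub we_ge0 we_ni W_finite x0 (ltW xy) ya).
have := V_incr_le x0 xy ya; rewrite -subr_gt0 => Vxy.
by rewrite inver (gt_eqF Vxy) -EFinM.
Qed.

Lemma slopeE x y : (0 <= x)%R -> (x < y)%R -> y%:E <= a ->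
  (F y - F x = slope x y * (V y - V x))%R.
Proof.
move=> x0 xy ya; rewrite /slope divfK// gt_eqF// subr_gt0; exact: V_incr_le.
Qed.

(** Continuity from the left that includes b = a, a point outside [indom]. *)
Lemma tilt_near b r e : (0 < b)%R -> b%:E <= a -> (0 < e)%R -> exists2 d : R, (0 < d)%R &
  forall s, (0 <= s)%R -> (b - d < s)%R -> (s <= b)%R ->
    (`|tilt F V r s - tilt F V r b| < e)%R.
Proof.
move=> b0 ba e0; have r1 : (0 < `|r| + 1)%R by have := normr_ge0 r; lra.
have e2 : (0 < e / 2)%R by lra.
have [d1 d10 H1] := prim_cont_pos fs_ge0 fs_ni fs_fin b0 ba e2.
have [d2 d20 H2] := prim_cont_pos we_ge0 we_ni W_finite b0 ba (divr_gt0 e2 r1).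
exists (Num.min d1 d2); first by rewrite lt_min d10.
move=> s s0 bs sb.
have sa : s%:E <= a by apply: le_trans ba; rewrite lee_fin.
have : (b - s < Num.min d1 d2)%R by lra.
rewrite lt_min => /andP[bs1 bs2].
have nb : (`|s - b| = b - s)%R by rewrite distrC ger0_norm// subr_ge0.
have h1 := H1 s s0 sa; have h2 := H2 s s0 sa; rewrite nb in h1 h2.
have {}h1 := h1 bs1; have {}h2 := h2 bs2.
have -> : (tilt F V r s - tilt F V r b = (F s - F b) - r * (V s - V b))%R by rewrite
  /tilt; ring.
apply: le_lt_trans (ler_normB _ _) _; rewrite normrM.
rewrite ltr_pdivlMr// in h2.
have h3 : (`|r| * `|V s - V b| <= e / 2)%R.
  by apply: ltW; apply: le_lt_trans h2; rewrite mulrC ler_wpM2l// lerDl.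
rewrite /F in h3 *; lra.
Qed.

Lemma end_slope_real x b : (0 <= x)%R -> (x < b)%R -> b%:E <= a ->
  end_slope F V x b%:E (slope x b).
Proof.
move=> x0 xb ba; have b0 : (0 < b)%R by lra.
have Vxb := V_incr_le x0 xb ba; have sE := slopeE x0 xb ba.
split=> [r M rl xM|r Hr].
  rewrite lte_fin => Mb.
  have e0 : (0 < (slope x b - r) * (V b - V x))%R by rewrite mulr_gt0// subr_gt0.
  have [d d0 H] := tilt_near r b0 ba e0.
  pose z := Num.max M (b - d)%R.
  have z1 : (M <= z)%R by rewrite le_max lexx.
  have z2 : (b - d <= z)%R by rewrite le_max lexx orbT.
  have z3 : (z < b)%R by rewrite gt_max Mb; lra.
  exists ((z + b) / 2)%R; rewrite lte_fin; split; [lra|lra|].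
  have := H ((z + b) / 2)%R ltac:(lra) ltac:(lra) ltac:(lra).
  by rewrite ltr_norml /tilt => /andP[+ _]; lra.
rewrite leNgt; apply/negP => lr.
have e0 : (0 < (r - slope x b) * (V b - V x))%R by rewrite mulr_gt0// subr_gt0.
have [d d0 H] := tilt_near r b0 ba e0.
pose z := Num.max ((x + b) / 2)%R (b - d)%R.
have z1 : ((x + b) / 2 <= z)%R by rewrite le_max lexx.
have z2 : (b - d <= z)%R by rewrite le_max lexx orbT.
have z3 : (z < b)%R by rewrite gt_max; apply/andP; split; lra.
have [||s [zs + hs]] := Hr z; rewrite ?lte_fin; [lra|lra|].
move=> sb; have := H s ltac:(lra) ltac:(lra) ltac:(lra).
by rewrite ltr_norml /tilt => /andP[_ +]; lra.
Qed.

Lemma end_slope_infty x : a = +oo -> (0 <= x)%R -> exists l,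
  limf_esup (Rfin a w f x) (pinfty_nbhs R) = l%:E /\ end_slope F V x +oo l.
Proof.
move=> ay x0; have ya (y : R) : y%:E <= a by rewrite ay leey.
have xI y : (0 <= y)%R -> indom a y by move=> y0; split=> //; rewrite ay ltry.
pose L := limf_esup (Rfin a w f x) (pinfty_nbhs R).
have L_lb r : (forall M, (x < M)%R ->
  exists s, (M < s)%R /\ (r * (V s - V x) <= F s - F x)%R) ->
    r%:E <= L.
  move=> H; rewrite /L limf_esupE; apply: le_ereal_inf_tmp => _ [B [M [_ MB]] <-].
  have [|s [Ms hs]] := H (Num.max M (x + 1))%R; first by rewrite lt_max ltrDl ltr01 orbT.
  move: Ms; rewrite gt_max => /andP[Ms xs].
  have xs' : (x < s)%R by lra.
  apply: le_ereal_sup_tmp; exists (Rfin a w f x s); first by exists s => //; exact: MB.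
  rewrite RfinE// lee_fin /slope ler_pdivlMr//.
  by rewrite subr_gt0; exact: V_incr_le.
have L_ub r M : r%:E < L -> (x < M)%R ->
  exists s, (M < s)%R /\ (r * (V s - V x) < F s - F x)%R.
  move=> rL xM.
  have /ereal_sup_gt[_ [s /= Ms <-]]
    : r%:E < ereal_sup [set Rfin a w f x t | t in [set t | (M < t)%R]].
    apply: lt_le_trans rL _; rewrite /L limf_esupE; apply: ereal_inf_lbound.
    by exists [set t | (M < t)%R] => //; exists M; split=> //; exact: num_real.
  have xs : (x < s)%R by lra.
  rewrite RfinE// lte_fin /slope ltr_pdivlMr; last by rewrite subr_gt0; exact: V_incr_le.
  by move=> hs; exists s.
have L0' : 0 <= L.
  apply: L_lb => M xM; exists (M + 1)%R; split; first by rewrite ltrDl.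
  by rewrite mul0r subr_ge0; apply: F_nd; try (apply: xI); lra.
pose D := (V (x + 1) - V x)%R.
have D0 : (0 < D)%R by rewrite subr_gt0; apply: V_incr_le => //; lra.
(* Beyond x + 1 the increment of [V] from [x] exceeds [D], so F <= C1 + C2 V bounds the slopes by
   the first two summands. *)
pose K := ((C1 + C2 * V x) / D + C2 + 1)%R.
have Vx0 : (0 <= V x)%R by rewrite -(prim0 we); apply: (prim_le we_ge0 we_ni W_finite).
have Fx0 : (0 <= F x)%R by rewrite -(prim0 fs); apply: (prim_le fs_ge0 fs_ni fs_fin).
have CV0 : (0 <= C1 + C2 * V x)%R by rewrite addr_ge0// mulr_ge0.
have LK : L <= K%:E.
  rewrite leNgt; apply/negP => /L_ub /(_ (_ : x < x + 1)%R) []; first by lra.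
  move=> s [xs hs].
  have sI := F_bound (xI s ltac:(lra)).
  have Ds : (D < V s - V x)%R by rewrite /D ltrD2r; apply: V_incr_le => //; lra.
  have h : ((C1 + C2 * V x) / D * D = C1 + C2 * V x)%R by rewrite divfK// gt_eqF.
  have h' : ((C1 + C2 * V x) / D * D <= (C1 + C2 * V x) / D * (V s - V x))%R.
    by apply: ler_wpM2l; [rewrite divr_ge0// ltW|exact: ltW].
  move: hs; rewrite /K; set q := ((C1 + C2 * V x) / D)%R in h h' *; lra.
have Lfin : L \is a fin_num.
  by rewrite ge0_fin_numE//; apply: le_lt_trans LK _; rewrite ltry.
exists (fine L); split; first by rewrite fineK.
split=> [r M rl xM _|r Hr].
  have [|s [Ms hs]] := L_ub r M _ xM; first by rewrite -(fineK Lfin) lte_fin.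
  by exists s; rewrite ltry.
rewrite -lee_fin fineK//; apply: L_lb => M xM.
by have [|s [Ms _ hs]] := Hr M xM; [rewrite ltry|exists s].
Qed.

Lemma Rratio_end_slope x y : (0 <= x)%R -> x%:E < y -> y <= a -> exists l,
  Rratio a w f x y = l%:E /\ end_slope F V x y l.
Proof.
case: y => [b| |] // x0.
  rewrite lte_fin => xb ba; exists (slope x b); rewrite /= RfinE//; split=> //.
  exact: end_slope_real.
by move=> _; rewrite leye_eq => /eqP ay; exact: end_slope_infty.
Qed.

Lemma oo_I_le x y : (0 <= x)%R -> x%:E < y -> oo x y `<=` I <-> y <= a.
Proof.
by move=> x0 xy; split=> [/(oo_subP xy)[]//|ya]; exact: oo_sub_I.
Qed.

Lemma level_intervalP x y : level_interval a w f x y <-> rise a F V x y.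
Proof.
split=> [[x0 xy xyI R0 HR]|r].
  have ya := (oo_I_le x0 xy).1 xyI.
  have [l [El sl]] := Rratio_end_slope x0 xy ya.
  apply/(level_riseP V_incr x0 xy ya sl); rewrite El lte_fin in R0; split=> // t xt ty.
  have ta : t%:E <= a by apply: ltW; exact: lt_le_trans ya.
  have /HR : oo x y t by rewrite /oo /= lte_fin xt.
  rewrite /= RfinE// El lee_fin (slopeE x0 xt ta) ler_pM2r// subr_gt0.
  exact: V_incr_le.
have [x0 xy ya _ _] := r.
have [l [El sl]] := Rratio_end_slope x0 xy ya.
have [l0 Hl] := (level_riseP V_incr x0 xy ya sl).2 r.
split=> //; first exact/(oo_I_le x0 xy); first by rewrite El lte_fin.
move=> t /andP[+ ty]; rewrite lte_fin => xt.
have ta : t%:E <= a by apply: ltW; exact: lt_le_trans ya.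
rewrite El /= RfinE// lee_fin; have := Hl t xt ty;
  rewrite (slopeE x0 xt ta) ler_pM2r// subr_gt0.
exact: V_incr_le.
Qed.

Lemma max_level_intervalP x y : max_level_interval a w f x y <-> max_rise a F V x y.
Proof.
split=> [[/level_intervalP r m]|[r m]]; split=> //.
- move=> x' y' r' xx' yy'; have [_ xy _ _ _] := r; have [_ xy' _ _ _] := r'.
  have /level_intervalP/m := r'; move=> H.
  apply: oo_inj => //; apply: H => t /andP[xt ty].
  by rewrite /oo /= (lt_le_trans ty yy') andbT (le_lt_trans _ xt)// lee_fin.
- exact/level_intervalP.
- move=> x' y' /level_intervalP r' sub; have [_ xy _ _ _] := r.
  have [h1 h2] := oo_subP xy sub.
  by have [-> ->] := m _ _ r' h1 h2.
Qed.

(** On a maximal level interval the line over it serves. Elsewhere [x] is below no chord, since a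
    chord above it would yield a maximal level interval around it; so the curve itself has a
    supporting line at [x]. The relation of its slope to f^* is left open here, as it holds only
    almost everywhere. *)
Lemma envelope_point x : I x -> exists p : R * R,
  [/\ forall t, indom a t -> (F t <= p.1 + p.2 * (V t - V x))%R,
      forall c m, (forall t, indom a t -> F t <= c + m * V t)%R -> (p.1 <= c + m * V x)%R &
      level_fun a w f x = (p.2 * w x)%:E \/ p.1 = F x /\ level_fun a w f x = fs x].
Proof.
move=> Ix; have xI := I_indom Ix; have /andP[+ _] := Ix; rewrite lte_fin => x0.
rewrite /level_fun; case: pselect => [ex|nex].
  case: cid2 => -[al be] /= mx /andP[+ xbe]; rewrite lte_fin => alx.
  have mr := (max_level_intervalP al be).1 mx.
  have [[al0 ab ba _ _] _] := mr.
  have [l [El sl]] := Rratio_end_slope al0 ab ba.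
  exists (F al + l * (V x - V al), l)%R => /=; split.
  - move=> t tI; have := max_rise_dominates F_cont V_cont F_nd V_incr mr sl tI; lra.
  - by move=> c m H; exact: (end_slope_le_affine V_incr al0 ba sl).
  - by left; rewrite El EFinM.
have nbc : ~ below_chord a F V x.
  move=> /(below_chord_rise F_cont V_cont F_nd V_incr) [al [be [r alx xbe _]]].
  have [|al' [be' [mr alx' xbe']]] := max_rise_exists F_cont V_cont F_nd r alx.
    by rewrite lte_fin.
  by apply: nex; exists (al', be'); [exact/max_level_intervalP|rewrite /oo /= lte_fin alx'].
have [l Hl] := contact_slope F_nd V_incr xI x0 nbc.
exists (F x, l) => /=; split; last by right.
- by move=> t /Hl; lra.
- by move=> c m; apply.
Qed.

Lemma envelope_exists : exists Phi k : R -> R, forall x, I x ->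
  [/\ forall t, indom a t -> (F t <= Phi x + k x * (V t - V x))%R,
      forall c m, (forall t, indom a t -> F t <= c + m * V t)%R ->
        (Phi x <= c + m * V x)%R &
      level_fun a w f x = (k x * w x)%:E \/ Phi x = F x /\ level_fun a w f x = fs x].
Proof.
have /choice[g Hg] : forall x, exists p : R * R, I x ->
  [/\ forall t, indom a t -> (F t <= p.1 + p.2 * (V t - V x))%R,
      forall c m, (forall t, indom a t -> F t <= c + m * V t)%R -> (p.1 <= c + m * V x)%R &
      level_fun a w f x = (p.2 * w x)%:E \/ p.1 = F x /\ level_fun a w f x = fs x].
  move=> x; have [Ix|nIx] := pselect (I x); last by exists (0, 0)%R.
  by have [p Hp] := envelope_point Ix; exists p.
by exists (fst \o g), (snd \o g) => x /Hg.
Qed.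

(** * The least majorant as the integral of k w *)

Section EnvelopeOfF.
Variables Phi k : R -> R.
Hypothesis Phi_support : forall x t, I x -> indom a t ->
  (F t <= Phi x + k x * (V t - V x))%R.
Hypothesis Phi_least : forall x c m, I x ->
  (forall t, indom a t -> F t <= c + m * V t)%R -> (Phi x <= c + m * V x)%R.
Hypothesis level_funE : forall x, I x ->
  level_fun a w f x = (k x * w x)%:E \/ Phi x = F x /\ level_fun a w f x = fs x.

(** The supporting line at [x] is an affine majorant of F, so minimality at [y] applies to it. *)
Lemma Phi_le x y : I x -> I y -> (Phi y - Phi x <= k x * (V y - V x))%R.
Proof.
move=> Ix Iy; have := @Phi_least y (Phi x - k x * V x) (k x) Iy.
move=> H; have {}H := H ltac:(move=> t /(Phi_support Ix); lra).
lra.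
Qed.

Lemma k_ni x y : I x -> I y -> (x <= y)%R -> (k y <= k x)%R.
Proof.
move=> Ix Iy; rewrite le_eqVlt => /orP[/eqP -> //|xy].
have Vxy := V_incr (I_indom Ix) (I_indom Iy) xy.
have h1 := Phi_le Ix Iy; have h2 := Phi_le Iy Ix.
have : (0 <= (k x - k y) * (V y - V x))%R by lra.
by rewrite pmulr_lge0 ?subr_ge0// subr_gt0.
Qed.

Lemma F_le_Phi x : I x -> (F x <= Phi x)%R.
Proof. by move=> Ix; have := Phi_support Ix (I_indom Ix); rewrite subrr mulr0 addr0. Qed.

(** If the line at [x] descended, its height at some y > x would bound F everywhere, before [y]
    because F is nondecreasing and after it by the line; this constant would be a majorant below
    [Phi x]. *)
Lemma k_ge0 x : I x -> (0 <= k x)%R.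
Proof.
move=> Ix; rewrite leNgt; apply/negP => k0.
have /andP[+ xa] := Ix; rewrite lte_fin => x0.
have [y xy ya] := exists_between xa.
have Iy : I y by apply: in_I => //; lra.
have Vxy := V_incr (I_indom Ix) (I_indom Iy) xy.
have := @Phi_least x (Phi x + k x * (V y - V x)) 0 Ix; rewrite mul0r addr0 => H.
suff : (Phi x <= Phi x + k x * (V y - V x))%R by nra.
apply: H => t tI; rewrite mul0r addr0.
have [ty|yt] := leP t y.
  exact: le_trans (F_nd tI (I_indom Iy) ty) (Phi_support Ix (I_indom Iy)).
have Vyt := V_incr (I_indom Iy) tI yt.
by have := Phi_support Ix tI; nra.
Qed.

Let ft (x : R) : R := (k x * w x)%R.

Lemma ft_ge0 x : I x -> (0 <= ft x)%R.
Proof. by move=> Ix; rewrite mulr_ge0 ?k_ge0// ltW// w_gt0. Qed.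

Lemma ft_ni x y : I x -> I y -> (x <= y)%R -> (ft y <= ft x)%R.
Proof.
move=> Ix Iy xy; apply: ler_pM;
  [exact: k_ge0|by rewrite ltW// w_gt0|exact: k_ni|exact: w_decreasing].
Qed.

Lemma interval_I : is_interval I.
Proof. exact: is_interval_oo. Qed.

Lemma measurable_I : measurable (I : set (Leb R)).
Proof. exact: measurable_oo. Qed.

Lemma L0_noninc (g : R -> R) : (forall x y, I x -> I y -> (x <= y)%R ->
  (g y <= g x)%R) -> L0 I g.
Proof.
move=> gni; apply/(measurable_EFinP (T := Leb R)).
by apply: noninc_measurable => [|x y Ix Iy xy]; [exact: interval_I|rewrite lee_fin gni].
Qed.

Lemma measurable_sub_I (g : R -> R) (p : R) (q : \bar R) : L0 I g -> (0 <= p)%R -> q <= a ->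
  measurable_fun (oo p q : set (Leb R)) (fun x : Leb R => (g x)%:E).
Proof.
move=> mg p0 qa; apply/(measurable_EFinP (T := Leb R)).
by apply: (@measurable_funS _ _ (Leb R) _ I) => //; [exact: measurable_I|exact: oo_sub_I].
Qed.

Lemma int_ft_bounds x y : (0 < x)%R -> (x <= y)%R -> y%:E < a ->
  (k y * (V y - V x))%:E <= \int[leb]_(t in oo x y%:E) (ft t)%:E <= (k x * (V y - V x))%:E.
Proof.
move=> x0 xy ya.
have Ix : I x by apply: in_I => //; apply: le_lt_trans ya; rewrite lee_fin.
have Iy : I y by apply: in_I => //; lra.
have sub t : oo x y%:E t -> I t /\ (x <= t <= y)%R.
  move=> /andP[xt ty]; rewrite !lte_fin in xt ty; split; last by rewrite !ltW.
  by apply: in_I; [lra|apply: lt_trans ya; rewrite lte_fin].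
have mw := measurable_sub_I (L0_noninc w_decreasing) (ltW x0) (ltW ya).
have mft := measurable_sub_I (L0_noninc ft_ni) (ltW x0) (ltW ya).
have cst_int c : (0 <= c)%R -> (c * (V y - V x))%:E = \int[leb]_(t in oo x y%:E) (c%:E *
  (w t)%:E).
  move=> c0; rewrite ge0_integralZl_EFin; [|exact: measurable_oo| |exact: mw|exact: c0].
    by rewrite (prim_sub we_ge0 we_ni W_finite (ltW x0) xy (ltW ya)).
  by move=> t /sub[/w_gt0 /ltW]; rewrite lee_fin.
apply/andP; split; rewrite cst_int ?k_ge0//; (apply: ge0_le_integral;
  [exact: measurable_oo| | | |]).
- by move=> t /sub[It _]; rewrite -EFinM lee_fin mulr_ge0 ?k_ge0// ltW// w_gt0.
- by apply: emeasurable_funM; [exact: measurable_cst|exact: mw].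
- exact: mft.
- move=> t /sub[It /andP[_ ty]]; rewrite -EFinM lee_fin ler_wpM2r ?k_ni// ltW// w_gt0//.
- by move=> t /sub[It _]; rewrite lee_fin ft_ge0.
- exact: mft.
- by apply: emeasurable_funM; [exact: measurable_cst|exact: mw].
- move=> t /sub[It /andP[xt _]]; rewrite -EFinM lee_fin ler_wpM2r ?k_ni// ltW// w_gt0//.
Qed.

(** [Phi] and the integral of k w obey the same increment bounds, so [primitive_unique] applies,
    with Lipschitz constant w(p) for [V]. *)
Lemma int_ft_pos p q : (0 < p)%R -> (p <= q)%R -> q%:E < a ->
  \int[leb]_(t in oo p q%:E) (ft t)%:E = (Phi q - Phi p)%:E.
Proof.
move=> p0 pq qa.
have pa : p%:E < a by apply: le_lt_trans qa; rewrite lee_fin.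
have Ip : I p by exact: in_I.
have inI x : (p <= x)%R -> (x <= q)%R -> I x.
  by move=> px xq; apply: in_I; [lra|apply: le_lt_trans qa; rewrite lee_fin].
(* truncation at p makes the primitive from 0 finite *)
pose h (t : R) : \bar R := (ft (Num.max p t))%:E.
have maxI x : I x -> I (Num.max p x) by move=> Ix; rewrite maxEle; case: ifP.
have h_ge0 x : I x -> 0 <= h x by move=> Ix; rewrite lee_fin; apply: ft_ge0; exact: maxI.
have h_ni x y : I x -> I y -> (x <= y)%R -> h y <= h x.
  move=> Ix Iy xy; rewrite lee_fin; apply: ft_ni; [exact: maxI|exact: maxI|].
  by rewrite ge_max !le_max lexx/= xy orbT.
have h_fin x : I x -> \int[leb]_(t in oo 0 x%:E) h t < +oo.
  move=> Ix; have /andP[x0 xa] := Ix; rewrite lte_fin in x0.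
  apply: (@le_lt_trans _ _ (\int[leb]_(t in oo 0 x%:E) cst (ft p)%:E t)).
    have sub : oo 0 x%:E `<=` I by apply: oo_sub_I => //; exact: ltW.
    apply: ge0_le_integral; [exact: measurable_oo|by move=> t /sub /h_ge0| |
      exact: measurable_cst|].
      apply: noninc_measurable; first exact: is_interval_oo.
      by move=> s t /sub Is /sub It; exact: h_ni.
    by move=> t /sub It; rewrite lee_fin; apply: ft_ni; [|exact: maxI|rewrite le_max lexx].
  rewrite integral_cst; last exact: measurable_oo.
  change ((ft p)%:E * leb (oo 0 x%:E) < +oo); rewrite leb_oo0 ?lee_fin ?ltW//.
  by rewrite -EFinM ltry.
have hft x y : (p <= x)%R -> (x <= y)%R -> (y <= q)%R ->
    (prim h y - prim h x)%:E = \int[leb]_(t in oo x y%:E) (ft t)%:E.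
  move=> px xy yq; have ya : y%:E <= a by apply: ltW; apply: le_lt_trans qa;
    rewrite lee_fin.
  rewrite -(prim_sub h_ge0 h_ni h_fin _ xy ya); last by lra.
  apply: eq_integral => t /set_mem /andP[+ _]; rewrite lte_fin => xt.
  by rewrite /h max_r//; lra.
rewrite -hft//; congr EFin; symmetry.
apply: (@primitive_unique R k V Phi (prim h) p q (w p)) => //.
- by rewrite ltW// w_gt0.
- move=> x y px xy yq.
  have Ix := inI x px (le_trans xy yq); have Iy := inI y (le_trans px xy) yq.
  have /andP[_ xa] := Ix; have /andP[_ ya] := Iy.
  apply: le_trans (prim_ub we_ge0 we_ni W_finite _ xy xa (ltW ya)) _; first by lra.
  by apply: ler_wpM2r; [rewrite subr_ge0|exact: w_decreasing].
- by move=> x y px xy yq; apply: k_ni => //; apply: inI => //; lra.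
- move=> x y px xy yq.
  have Ix := inI x px (le_trans xy yq); have Iy := inI y (le_trans px xy) yq.
  have h1 := Phi_le Ix Iy; have h2 := Phi_le Iy Ix.
  by apply/andP; split; lra.
- move=> x y px xy yq.
  have ya : y%:E < a by apply: le_lt_trans qa; rewrite lee_fin.
  by rewrite -!lee_fin hft//; apply: int_ft_bounds => //; lra.
Qed.

(** Up to some [z] continuity gives F < c, and past [z] the constant [C1] is absorbed into (C1 / V
    z) V. Through minimality, an arbitrarily small value at 0 forces [Phi] to tend to 0 there. *)
Lemma F_le_affine c : (0 < c)%R -> exists2 m, (0 <= m)%R & forall t, indom a t ->
  (F t <= c + m * V t)%R.
Proof.
move=> c0; have [d d0 Hd] := prim_cont0 a_gt0 fs_ge0 fs_ni fs_fin c0.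
have [x x0 xa] := exists_in_I a_gt0.
pose z := Num.min (d / 2)%R x.
have z0 : (0 < z)%R by rewrite lt_min x0 andbT; lra.
have zx : (z <= x)%R by rewrite ge_min lexx orbT.
have zd : (z <= d / 2)%R by rewrite ge_min lexx.
have Iz : I z by apply: in_I => //; apply: le_lt_trans xa; rewrite lee_fin.
have Vz := V_gt0 Iz.
have m0 : (0 <= C1 / V z)%R by rewrite divr_ge0// ltW.
exists (C1 / V z + C2)%R; first by rewrite addr_ge0.
move=> t tI; have [t0 ta] := tI; have Vt : (0 <= V t)%R.
  by rewrite -(prim0 we); apply: (prim_le we_ge0 we_ni W_finite) => //; exact: ltW.
have [tz|zt] := ltP t z.
  have : (F t < c)%R by apply: Hd => //; [lra|exact: ltW].
  have : (0 <= (C1 / V z + C2) * V t)%R by rewrite mulr_ge0// addr_ge0.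
  lra.
have := F_bound tI.
have Vzt : (V z <= V t)%R by apply: (prim_le we_ge0 we_ni W_finite) => //;
  [exact: ltW|exact: ltW].
have : (C1 / V z * V z = C1)%R by rewrite divfK// gt_eqF.
have : (C1 / V z * V z <= C1 / V z * V t)%R by rewrite ler_wpM2l.
lra.
Qed.

Lemma int_ft x : I x -> \int[leb]_(t in oo 0 x%:E) (ft t)%:E = (Phi x)%:E.
Proof.
move=> Ix; have /andP[+ xa] := Ix; rewrite lte_fin => x0.
have mft := measurable_sub_I (L0_noninc ft_ni) (lexx 0%R) (ltW xa).
have sub : oo 0 x%:E `<=` I by apply: oo_sub_I => //; exact: ltW.
have Phi0 p : I p -> (0 <= Phi p)%R.
  move=> Ip; apply: le_trans (F_le_Phi Ip); have /andP[+ pa] := Ip; rewrite lte_fin => p0.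
  by rewrite -(prim0 fs); apply: (prim_le fs_ge0 fs_ni fs_fin) => //; exact: ltW.
apply/eqP; rewrite eq_le; apply/andP; split.
  apply: int_oo0_le => //; first by move=> t /sub It; rewrite lee_fin ft_ge0.
  move=> p p0 px; rewrite int_ft_pos// lee_fin gerBl; apply: Phi0; apply: in_I => //.
  by apply: le_lt_trans xa; rewrite lee_fin.
apply/lee_addgt0Pr => e e0; have e2 : (0 < e / 2)%R by lra.
have [m m0 Hm] := F_le_affine e2.
have m1 : (0 < m + 1)%R by lra.
have [d d0 Hd] := prim_cont0 a_gt0 we_ge0 we_ni W_finite (divr_gt0 e2 m1).
pose p := Num.min (d / 2)%R x.
have p0 : (0 < p)%R by rewrite lt_min x0 andbT; lra.
have px : (p <= x)%R by rewrite ge_min lexx orbT.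
have pd : (p <= d / 2)%R by rewrite ge_min lexx.
have pa : p%:E < a by apply: le_lt_trans xa; rewrite lee_fin.
have Ip : I p by exact: in_I.
have h1 := Phi_least Ip Hm.
have Vp := V_gt0 Ip.
have : (V p < e / 2 / (m + 1))%R by apply: Hd; [lra|lra|exact: ltW].
rewrite ltr_pdivlMr// => h2.
have h3 : (Phi p <= e)%R by nra.
apply: (@le_trans _ _ ((Phi x - Phi p)%:E + e%:E)).
  by rewrite -EFinD lee_fin; lra.
apply: leeD => //; rewrite -int_ft_pos//.
apply: ge0_subset_integral; [exact: measurable_oo|exact: measurable_oo|exact: mft| |].
- by move=> t /sub It; rewrite lee_fin ft_ge0.
- move=> t /andP[pt tx]; rewrite /oo /= tx andbT; apply: le_lt_trans pt.
  by rewrite lee_fin ltW.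
Qed.

(** At a contact point, the supporting line gives f^*(s) >= k(x) w(x) for every s < x, which passes
    to [x] wherever f^* is left continuous. The opposite inequality needs no exceptional set, f^*
    being right continuous. *)
Lemma level_fun_ae : ae_on I (fun x => level_fun a w f x = (ft x)%:E).
Proof.
apply: (ae_on1 (ae_left_limit_le fs_ni)) => x Ix left.
have [//|[Phix ->]] := level_funE Ix.
have xI := I_indom Ix; have /andP[+ xa] := Ix; rewrite lte_fin => x0.
apply/eqP; rewrite eq_le; apply/andP; split; last first.
  apply: left => s Is sx; have sI := I_indom Is.
  have /andP[s0 sa] := Is; rewrite lte_fin in s0.
  have h1 := Phi_support Ix sI; rewrite Phix in h1.
  have h2 := prim_lb we_ge0 we_ni W_finite (ltW s0) (ltW sx) Ix.
  have h3 := prim_ub fs_ge0 fs_ni fs_fin s0 (ltW sx) sa (ltW xa).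
  rewrite -(h_fineK fs_ge0 fs_ni fs_fin Is) lee_fin /ft.
  rewrite -(@ler_pM2r _ (x - s)%R) ?subr_gt0// -mulrA.
  have h4 := ler_wpM2l (k_ge0 Ix) h2; rewrite /= in h4.
  by rewrite -/F -/V in h1 h3 h4; lra.
rewrite leNgt; apply/negP => lt.
have ft0 := ft_ge0 Ix.
have reg := regular_decr measurable_I f_L0.
(* Read through the distribution function, the strict inequality leaves room for some t > x with
   f^*(t) still above k(x) w(x); then F would rise above the supporting line. *)
rewrite /fs /decr (rearr_gt reg _ ft0) in lt.
have [t xt] : exists2 t : R, (x < t)%R & t%:E < mine a (distr I leb f (ft x)).
  by apply: exists_between; rewrite lt_min xa.
rewrite lt_min => /andP[ta td].
have It : I t by apply: in_I => //; lra.
have tI := I_indom It.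
rewrite -(rearr_gt reg _ ft0) -/(decr I f) -/fs -(h_fineK fs_ge0 fs_ni fs_fin It) lte_fin
  in td.
have h1 := Phi_support Ix tI; rewrite Phix in h1.
have h2 := prim_ub we_ge0 we_ni W_finite x0 (ltW xt) xa (ltW ta).
have h3 := prim_lb fs_ge0 fs_ni fs_fin (ltW x0) (ltW xt) It.
have h4 := ler_wpM2l (k_ge0 Ix) h2; rewrite /= in h4.
have : (ft x * (t - x) < fine (fs t) * (t - x))%R by rewrite ltr_pM2r// subr_gt0.
rewrite /ft -mulrA.
by rewrite -/F -/V in h1 h3 h4; lra.
Qed.

End EnvelopeOfF.

Lemma level_fun_envelope : exists Phi k : R -> R, [/\
  forall x c m, I x -> (forall t, indom a t -> F t <= c + m * V t)%R ->
    (Phi x <= c + m * V x)%R,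
  forall x, I x -> (F x <= Phi x)%R,
  forall x, I x -> (0 <= k x)%R,
  forall x y, I x -> I y -> (x <= y)%R -> (k y <= k x)%R &
  (forall x, I x -> \int[leb]_(t in oo 0 x%:E) (k t * w t)%:E = (Phi x)%:E) /\
  ae_on I (fun x => level_fun a w f x = (k x * w x)%:E)].
Proof.
have [Phi [k H]] := envelope_exists.
have h1 x t (Ix : I x) : indom a t ->
  (F t <= Phi x + k x * (V t - V x))%R by have [+ _ _] := H _ Ix; exact.
have h2 x c m (Ix : I x) : (forall t, indom a t -> F t <= c + m * V t)%R ->
  (Phi x <= c + m * V x)%R.
  by have [_ + _] := H _ Ix; exact.
have h3 x (Ix : I x) : level_fun a w f x = (k x * w x)%:E \/ Phi x = F x /\ level_fun a w
  f x = fs x.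
  by have [_ _] := H _ Ix.
exists Phi, k; split=> //.
- by move=> x Ix; exact: (F_le_Phi h1).
- by move=> x Ix; exact: (k_ge0 h1 h2).
- by move=> x y; exact: (k_ni h1 h2).
- by split=> [x Ix|]; [exact: (int_ft h1 h2)|exact: (level_fun_ae h1 h2 h3)].
Qed.

End LevelFunction.

(** * Finiteness of rearrangements *)

Section Misc.
Context {R : realType}.
Notation leb := (@completed_lebesgue_measure R).

Lemma ae_on_oo_exists (c : \bar R) (P : R -> Prop) x : ae_on (oo 0 c) P -> oo 0 c x ->
  exists y, [/\ (0 < y)%R, (y < x)%R & P y].
Proof.
move=> [B [mB B0 hB]] /andP[x0 xc]; rewrite lte_fin in x0.
apply: contrapT => nex.
have sub : oo 0 x%:E `<=` B.
  move=> y /andP[y0 yx]; rewrite !lte_fin in y0 yx; apply: hB => /= h; apply: nex;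
    exists y; split=> //.
  by apply: h; rewrite /oo /= lte_fin y0 (lt_trans _ xc)// lte_fin.
have : leb (oo 0 x%:E) <= leb B.
  by apply: le_measure => //; rewrite inE//; exact: measurable_oo.
rewrite B0 leb_oo0; last by rewrite lee_fin ltW.
by rewrite lee_fin leNgt x0.
Qed.

Lemma rearr_lty (D : set R) mu (f : R -> R) (c : \bar R) x :
  ae_on (oo 0 c) (fun x => rearr D mu f x \is a fin_num) -> oo 0 c x ->
    rearr D mu f x < +oo.
Proof.
move=> ae cx; have [y [y0 yx fy]] := ae_on_oo_exists ae cx.
by apply: le_lt_trans (rearr_noninc _ _ _ (ltW yx)) _; rewrite -ge0_fin_numE// rearr_ge0.
Qed.

Lemma L0_fine (c : \bar R) (h : R -> \bar R) : (forall x, oo 0 c x -> h x \is a fin_num) ->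
  (forall x y, oo 0 c x -> oo 0 c y -> (x <= y)%R -> h y <= h x) -> L0 (oo 0 c) (fine \o h).
Proof.
move=> fin ni; apply: L0_noninc => x y Ix Iy xy.
by apply: fine_le; [exact: fin|exact: fin|exact: ni].
Qed.

Lemma ae_onT (D : set R) (P : R -> Prop) : (forall x, D x -> P x) -> ae_on D P.
Proof. by move=> H; apply: (@ae_on_sub _ _ _ set0) => [|x Dx _];
  [exact: negligible_set0|exact: H]. Qed.

Lemma ae_on_subset (A D : set R) (P : R -> Prop) : A `<=` D -> ae_on D P -> ae_on A P.
Proof. by move=> AD [B [mB B0 hB]]; exists B; split=> // x /= nP; apply: hB => /= DP;
  apply: nP => /AD. Qed.

End Misc.

(** * Rearrangements with respect to w dm *)

Section WeightedRearrangement.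
Context {R : realType}.
Notation leb := (@completed_lebesgue_measure R).
Variables (a : \bar R) (w : R -> R).
Hypothesis a_gt0 : 0 < a.
Hypothesis w_gt0 : forall t : R, I_a a t -> (0 < w t)%R.
Hypothesis w_decreasing : forall s t : R, I_a a s -> I_a a t -> (s <= t)%R ->
  (w t <= w s)%R.
Hypothesis W_finite : forall t : R, I_a a t -> W w t < +oo.

Let I := I_a a.
Let J := J_w a w.
Let we (t : R) : \bar R := (w t)%:E.
Let V := prim we.
Let ge0 := we_ge0 w_gt0.
Let ni := we_ni w_decreasing.
Let w_L0 : L0 I w := L0_noninc w_decreasing.
Let w_ge0 x (Ix : I x) : (0 <= w x)%R := ltW (w_gt0 Ix).

Lemma distr_wlebE (f : R -> R) s :
  distr I (wleb a w) f s = \int[leb]_(x in I `&` [set x | (s < `|f x|)%R]) (w x)%:E.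
Proof.
rewrite /distr /wleb; congr (integral _ _ _).
by apply/seteqP; split=> x /=; [move=> [? []]|move=> [? ?]].
Qed.

Lemma regular_decr_w (f : R -> R) : L0 I f -> regular_distr I (wleb a w) f.
Proof.
move=> mf; apply: (@regular_mass R I w) => //; first exact: measurable_I.
exact: distr_wlebE.
Qed.

Lemma distr_w_le (f : R -> R) s : L0 I f -> distr I (wleb a w) f s <= b_w a w.
Proof.
move=> mf; rewrite distr_wlebE; apply: ge0_subset_integral.
- by apply: (@measurable_gt R I) => //; exact: measurable_I.
- exact: measurable_I.
- exact/(measurable_EFinP (T := Leb R)).
- by move=> x Ix; rewrite lee_fin w_ge0.
- by move=> x [].
Qed.

Lemma int_w x : I x -> \int[leb]_(t in oo 0 x%:E) (w t)%:E = (V x)%:E.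
Proof.
move=> Ix; have /andP[x0 xa] := Ix; apply: (primE ge0 ni W_finite); last exact: ltW.
by rewrite -lee_fin ltW.
Qed.

Lemma exists_V_le u : (0 < u)%R -> exists2 x, I x & (V x <= u)%R.
Proof.
move=> u0; have [d d0 Hd] := prim_cont0 a_gt0 ge0 ni W_finite u0.
have [x x0 xa] := exists_in_I a_gt0.
pose z := Num.min (d / 2)%R x.
have z0 : (0 < z)%R by rewrite lt_min x0 andbT; lra.
have zx : (z <= x)%R by rewrite ge_min lexx orbT.
have zd : (z <= d / 2)%R by rewrite ge_min lexx.
have za : z%:E < a by apply: le_lt_trans xa; rewrite lee_fin.
exists z; first exact: in_I.
by apply: ltW; apply: Hd; [lra|lra|exact: ltW].
Qed.

Lemma V_onto u : J u -> exists2 x, I x & V x = u.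
Proof.
move=> /andP[+ ub]; rewrite lte_fin => u0.
have [x1 Ix1 ux1] := prim_unbounded a_gt0 ge0 ni W_finite (ltW u0) ub.
have /andP[+ x1a] := Ix1; rewrite lte_fin => x10.
have Vc := V_cont a_gt0 w_gt0 w_decreasing W_finite.
pose S := [set x | [/\ (0 <= x)%R, (x <= x1)%R & (V x <= u)%R]].
have S0 : S 0%R by split; [by []|exact: ltW|rewrite /V prim0 ltW].
have S_sup : has_sup S by split; [exists 0%R|exists x1 => x []].
set x0 := sup S.
have S_le x : S x -> (x <= x0)%R by move=> Sx; apply: ub_le_sup => //; case: S_sup.
have x00 : (0 <= x0)%R by exact: S_le.
have x0x1 : (x0 <= x1)%R by apply: ge_sup; [exists 0%R|move=> x []].
have x0I : indom a x0 by split=> //; apply: le_lt_trans x1a; rewrite lee_fin.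
have inx y : (0 <= y)%R -> (y <= x1)%R -> indom a y.
  by move=> y0 yx1; split=> //; apply: le_lt_trans x1a; rewrite lee_fin.
have [Vlt|Vgt|E] := ltgtP (V x0) u.
- have [d d0 Hd] := cont_lt Vc x0I Vlt.
  pose y := Num.min x1 (x0 + d / 2)%R.
  have y1 : (y <= x1)%R by rewrite ge_min lexx.
  have y2 : (y <= x0 + d / 2)%R by rewrite ge_min lexx orbT.
  have y3 : (x0 <= y)%R by rewrite le_min x0x1; lra.
  have Vy : (V y < u)%R.
    by apply: Hd; [apply: inx; lra|rewrite ger0_norm; lra].
  have yx0 : (y <= x0)%R by apply: S_le; split; [lra|by []|exact: ltW].
  have yE : y = x1 by move: yx0; rewrite /y minEle; case: ifP => // _; lra.
  by move: Vy ux1; rewrite yE /V; lra.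
- have [d d0 Hd] := cont_gt Vc x0I Vgt.
  have [y Sy yd] := sup_adherent d0 S_sup.
  have yx0 := S_le _ Sy; case: Sy => y0 yx1 Vy.
  have : (u < V y)%R.
    by apply: Hd; [exact: inx|rewrite ler0_norm; rewrite -/x0 in yd; lra].
  lra.
- exists x0 => //; apply: in_I; last by case: x0I.
  rewrite lt_neqAle x00 andbT; apply/eqP => E0.
  by move: E; rewrite -E0 /V prim0; lra.
Qed.

Section Decreasing.
Variable k : R -> R.
Hypothesis k_ge0 : forall x, I x -> (0 <= k x)%R.
Hypothesis k_ni : forall x y, I x -> I y -> (x <= y)%R -> (k y <= k x)%R.

(** Outside (0, x) the function [k] is at most [k x], and (0, x) has w-mass at most [u] for small
    [x]. Finiteness thus precedes any knowledge of membership in E. *)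
Lemma decr_w_lty u : J u -> decr_w a w k u < +oo.
Proof.
move=> /andP[+ _]; rewrite lte_fin => u0; have [x Ix Vx] := exists_V_le u0.
apply: (@le_lt_trans _ _ (k x)%:E); last by rewrite ltry.
have reg := regular_decr_w (L0_noninc k_ni).
rewrite /decr_w (rearr_le reg _ (k_ge0 Ix)) distr_wlebE.
apply: (@le_trans _ _ (V x)%:E); last by rewrite lee_fin.
have /andP[_ xa] := Ix.
rewrite -int_w//; apply: ge0_subset_integral.
- by apply: (@measurable_gt R I);
  [exact: measurable_I|exact: (L0_noninc k_ni)|exact: measurable_I|].
- exact: measurable_oo.
- by apply: (measurable_sub_I w_L0) => //; exact: ltW.
- by move=> t /(oo_sub_I (lexx _) (ltW xa)) It; rewrite lee_fin w_ge0.
- move=> t /= [It]; rewrite ger0_norm ?k_ge0// => kt.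
  have /andP[t0 _] := It; rewrite /oo /= t0 lte_fin ltNge; apply/negP => xt.
  by have := k_ni Ix It xt; lra.
Qed.

(** The equality case of Hardy-Littlewood: (0, x) is nested with the superlevel sets of the
    decreasing [k]. *)
Lemma int_decr_w_le x : I x ->
  \int[leb]_(u in oo 0 (V x)%:E) decr_w a w k u <= \int[leb]_(t in oo 0 x%:E) (k t * w
    t)%:E.
Proof.
move=> Ix; have /andP[_ xa] := Ix.
have sub := oo_sub_I (lexx 0%R) (ltW xa).
have mk := L0_noninc k_ni.
have := @hardy_littlewood_initial R I w (wleb a w) k (measurable_I a) w_L0 w_ge0 mk
  (distr_wlebE k) (oo 0 x%:E) (measurable_oo _ _) sub.
rewrite int_w// => H; apply: le_trans (H _) _.
  move=> s s0; have [ks|ks] := pselect (exists2 t, oo 0 x%:E t & (k t <= s)%R);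
    [right|left].
    case: ks => t tx kts y /= [Iy]; rewrite ger0_norm ?k_ge0// => sy.
    have /andP[y0 _] := Iy; rewrite /oo /= y0 lte_fin ltNge; apply/negP => xy.
    have /andP[_ +] := tx; rewrite lte_fin => tx'.
    by have := k_ni (sub _ tx) Iy (le_trans (ltW tx') xy); lra.
  move=> t tx /=; rewrite ltNge; apply/negP => kts; apply: ks; exists t => //.
  by rewrite ger0_norm ?k_ge0// in kts; exact: sub.
rewrite le_eqVlt; apply/orP; left; apply/eqP; apply: eq_integral => t /set_mem /sub It.
by rewrite -EFinM ger0_norm ?k_ge0// mulrC.
Qed.

End Decreasing.

Lemma decr_div_w_lty (g : R -> R) t : ae_on I (fun x => decr_div_w a w g x \is a fin_num) ->
  I t -> decr I g t < +oo.
Proof.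
move=> ae It; have [y [y0 yt fy]] := ae_on_oo_exists ae It.
have /andP[_ ta] := It.
have Iy : I y by apply: in_I => //; apply: lt_trans ta; rewrite lte_fin.
apply: le_lt_trans (rearr_noninc _ _ _ (ltW yt)) _.
move: fy; rewrite /decr_div_w -/(decr I g y) -/I; have := rearr_ge0 I leb g y;
  rewrite -/(decr I g y).
case: (decr I g y) => [r| |] // _; first by rewrite ltry.
by rewrite inver gt_eqF ?w_gt0// gt0_mulye// lte_fin invr_gt0 w_gt0.
Qed.

Lemma decr_div_wE (g : R -> R) t : I t -> decr I g t < +oo ->
  decr_div_w a w g t = (fine (decr I g t) / w t)%:E.
Proof.
move=> It gt; rewrite /decr_div_w inver gt_eqF ?w_gt0// EFinM fineK//.
by rewrite ge0_fin_numE// rearr_ge0.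
Qed.

Lemma L0_decr_div_w (g : R -> R) : (forall t, I t -> decr I g t < +oo) ->
  L0 I (fine \o decr_div_w a w g).
Proof.
move=> fin.
have mg : L0 I (fine \o decr I g).
  apply: L0_fine => [x Ix|x y _ _]; last exact: rearr_noninc.
  by rewrite ge0_fin_numE ?rearr_ge0//; exact: fin.
have mi : L0 I (fun t => - (w t)^-1)%R.
  apply: L0_noninc => x y Ix Iy xy; rewrite lerN2 lef_pV2 ?posrE ?w_gt0//.
  exact: w_decreasing.
apply: (@L0_ae _ _ (fun t => (fine (decr I g t) * - - (w t)^-1)%R)).
  apply: measurable_funM; first exact: mg.
  exact: (measurableT_comp (@measurable_realfun.oppr_measurable R setT) mi).
by apply: ae_onT => t It; rewrite /= decr_div_wE ?fin//= opprK.
Qed.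

Lemma int_decr_le_decr_w (g : R -> R) x : (forall t, I t -> decr I g t < +oo) -> I x ->
  \int[leb]_(t in oo 0 x%:E) decr I g t <=
  \int[leb]_(u in oo 0 (V x)%:E) decr_w a w (fine \o decr_div_w a w g) u.
Proof.
move=> fin Ix; have /andP[_ xa] := Ix.
have sub := oo_sub_I (lexx 0%R) (ltW xa).
have mh := L0_decr_div_w fin.
have := @hardy_littlewood R I w (wleb a w) _ (measurable_I a) w_L0 w_ge0 mh
  (distr_wlebE _) (oo 0 x%:E) (measurable_oo _ _) sub.
rewrite int_w//; apply: le_trans.
rewrite le_eqVlt; apply/orP; left; apply/eqP; apply: eq_integral => t /set_mem /sub It.
have gt := fin _ It; have wt := w_gt0 It.
rewrite /= decr_div_wE//= ger0_norm; last by rewrite divr_ge0 ?fine_ge0 ?rearr_ge0// ltW.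
rewrite -EFinM mulrCA divff ?gt_eqF// mulr1 fineK//.
by rewrite ge0_fin_numE// rearr_ge0.
Qed.

(* A bound of F by the concave function x |-> H (V x), H the primitive of the
   rearrangement of h, passes to the supporting lines of H, hence to c. *)
Lemma least_majorant_le (F h : R -> R) (c : R) x : I x ->
  (forall p m, (forall t, indom a t -> F t <= p + m * V t)%R -> (c <= p + m * V x)%R) ->
  F 0%R = 0%R ->
  (forall t, I t -> (F t)%:E <= \int[leb]_(u in oo 0 (V t)%:E) decr_w a w h u) ->
  c%:E <= \int[leb]_(u in oo 0 (V x)%:E) decr_w a w h u.
Proof.
move=> Ix least F0 FH; set r := decr_w a w h.
have V0 := V_gt0 w_gt0 w_decreasing W_finite.
have Vx0 : (0 < V x)%R := V0 _ Ix.
have r_ge0 u : I_a +oo u -> 0 <= r u by move=> _; exact: rearr_ge0.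
have r_ni u v : I_a +oo u -> I_a +oo v -> (u <= v)%R -> r v <= r u by move=> _ _;
  exact: rearr_noninc.
have Ipos (u : R) : (0 < u)%R -> I_a +oo u by move=> u0;
  rewrite /I_a /oo /= ltry lte_fin u0.
have [Hfin|] := ltP (\int[leb]_(u in oo 0 (V x)%:E) r u) +oo;
  last by rewrite leye_eq => /eqP ->; rewrite leey.
have rfin : r (V x) < +oo.
  have h1 := int_ge_cst r_ge0 r_ni (lexx 0%R) (ltW Vx0) (Ipos _ Vx0).
  have := le_lt_trans h1 Hfin; rewrite subr0.
  have := r_ge0 _ (Ipos _ Vx0).
  case: (r (V x)) => [z| |] // _; first by move=> _; rewrite ltry.
  by rewrite gt0_mulye ?lte_fin.
(* Finiteness at [V x] spreads to the right, where [r] is bounded by [r (V x)]. *)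
have r_fin u : I_a +oo u -> \int[leb]_(t in oo 0 u%:E) r t < +oo.
  move=> /andP[+ _]; rewrite lte_fin => u0; have [ux|xu] := leP u (V x).
    apply: le_lt_trans Hfin; apply: ge0_subset_integral.
    - exact: measurable_oo.
    - exact: measurable_oo.
    - exact: measurable_rearr.
    - by move=> t _; exact: rearr_ge0.
    - by move=> t /andP[t0 tu]; rewrite /oo /= t0 (lt_le_trans tu)// lee_fin.
  rewrite (int_split r_ge0 r_ni (ltW Vx0) (_ : _ < u%:E)) ?lte_fin ?leey//.
  apply: lte_add_pinfty => //.
  apply: le_lt_trans (int_le_cst r_ge0 r_ni Vx0 (ltW xu) (ltry _) (leey _)) _.
  have := r_ge0 _ (Ipos _ Vx0).
  by case: (r (V x)) rfin => [z| |] // _ _; rewrite -EFinM ltry.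
have PE u : (0 <= u)%R -> \int[leb]_(t in oo 0 u%:E) r t = (prim r u)%:E.
  by move=> u0; apply: (primE r_ge0 r_ni r_fin) => //; exact: leey.
rewrite PE ?(ltW Vx0)// lee_fin.
have line u : (0 <= u)%R -> (prim r u <= prim r (V x) + fine (r (V x)) * (u - V x))%R.
  move=> u0; have [ux|xu] := leP u (V x).
    by have := prim_lb r_ge0 r_ni r_fin u0 ux (Ipos _ Vx0); lra.
  by have := prim_ub r_ge0 r_ni r_fin Vx0 (ltW xu) (ltry _) (leey _); lra.
have := least (prim r (V x) - fine (r (V x)) * V x)%R (fine (r (V x))).
move=> H; have {}H := H ltac:(idtac); apply: le_trans (H _) _; last by lra.
move=> t [t0 ta]; have [->|tn0] := eqVneq t 0%R.
  have VV0 : V 0 = 0%R := prim0 _.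
  by rewrite F0 VV0; have := line 0%R (lexx _); rewrite prim0; lra.
have It : I t by apply: in_I => //; rewrite lt_neqAle eq_sym tn0.
have := FH _ It; rewrite PE ?(ltW (V0 _ It))// lee_fin => h1.
apply: le_trans h1 _; apply: le_trans (line _ (ltW (V0 _ It))) _.
by rewrite mulrBr addrA addrAC.
Qed.

End WeightedRearrangement.

(** * Decreasing functions are their own rearrangements *)

Section DecreasingRearrangement.
Context {R : realType}.
Notation leb := (@completed_lebesgue_measure R).
Variable a : \bar R.
Let I := I_a a.

(** The set where g > g(x) lies in (0, x), whence g^*(x) <= g(x). For s < x, a value of g^*(s) below
    g(x) would make the set where [g] exceeds it contain (0, x), which is longer than [s]; left
    continuity of g^* then reaches [x]. *)
Lemma decr_noninc_ae (g : R -> R) : (forall x, I x -> (0 <= g x)%R) ->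
  (forall x y, I x -> I y -> (x <= y)%R -> (g y <= g x)%R) ->
  ae_on I (fun x => decr I g x = (g x)%:E).
Proof.
move=> g0 gni; have mg := L0_noninc gni.
have reg := regular_decr (measurable_I a) mg.
have ni x y : I x -> I y -> (x <= y)%R -> decr I g y <= decr I g x by move=> _ _;
  exact: rearr_noninc.
apply: (ae_on1 (ae_left_limit_le ni)) => x Ix left.
have /andP[x0 xa] := Ix.
apply/eqP; rewrite eq_le; apply/andP; split.
  rewrite /decr (rearr_le reg _ (g0 _ Ix)).
  apply: (@le_trans _ _ (leb (oo 0 x%:E))); last first.
    by rewrite leb_oo0; [exact: lexx|exact: ltW].
  apply: le_measure.
  - by rewrite inE; apply: (@measurable_gt R I) => //; exact: measurable_I.
  - by rewrite inE; exact: measurable_oo.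
  move=> t /= [It]; rewrite ger0_norm ?g0// => gt.
  have /andP[t0 _] := It; rewrite /oo /= t0 lte_fin ltNge; apply/negP => xt.
  by have := gni _ _ Ix It xt; lra.
apply: left => s Is sx; rewrite leNgt; apply/negP => lt.
have sfin : decr I g s \is a fin_num.
  by rewrite ge0_fin_numE ?rearr_ge0//; apply: lt_trans lt _; rewrite ltry.
pose r := fine (decr I g s).
have rE : r%:E = decr I g s by rewrite /r fineK.
have r0 : (0 <= r)%R by rewrite /r fine_ge0// rearr_ge0.
rewrite -rE lte_fin in lt.
have : ~~ (r%:E < decr I g s) by rewrite rE ltxx.
rewrite /decr (rearr_gt reg _ r0) => /negP; apply.
apply: (@lt_le_trans _ _ (leb (oo 0 x%:E))).
  by rewrite leb_oo0; [rewrite lte_fin|exact: ltW].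
apply: le_measure.
- by rewrite inE; exact: measurable_oo.
- by rewrite inE; apply: (@measurable_gt R I) => //; exact: measurable_I.
move=> t /andP[t0 tx]; rewrite lte_fin in tx.
have It : I t by rewrite /I /I_a /oo /= t0 (lt_trans _ xa)// lte_fin.
split=> //=; rewrite ger0_norm ?g0//; apply: lt_le_trans lt _.
by apply: gni => //; exact: ltW.
Qed.

Lemma eq_decr_ae (f g : R -> R) : L0 I f -> L0 I g -> ae_on I (fun x => f x = g x) ->
  decr I f = decr I g.
Proof.
move=> mf mg fg; apply: eq_rearr => s s0.
rewrite !distr_lebE//; try exact: measurable_I.
exact: (@eq_mass_ae R I (cst 1%R) f g s (measurable_I a) (measurable_cst _) (fun _ _ =>
  ler01) mf mg fg).
Qed.

End DecreasingRearrangement.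

(** * The affine bound on F from L_1 + M_W, and the theorem *)

Lemma L1_plus_M_W_bound (R : realType) (a : \bar R) (w f : R -> R) : 0 < a ->
  (forall t, I_a a t -> (0 < w t)%R) ->
  (forall s t : R, I_a a s -> I_a a t -> (s <= t)%R -> (w t <= w s)%R) ->
  (forall t : R, I_a a t -> W w t < +oo) -> L1_plus_M_W a w f ->
  exists C1 C2 : R, [/\ (0 <= C1)%R, (0 <= C2)%R & forall x, I_a a x ->
    \int[leb]_(t in oo 0 x%:E) decr (I_a a) f t <= C1%:E + C2%:E * W w x].
Proof.
move=> a0 w0 wni Wfin [mf [g [h [g1 [mh hM] fgh]]]].
have mI := measurable_I a.
have /integrableP[mg gfin] := g1.
have {}mg : L0 (I_a a) g by apply/(measurable_EFinP (T := Leb R)).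
set S := ereal_sup _ in hM.
have WE x : I_a a x -> W w x = (prim (fun t => (w t)%:E) x)%:E.
  by move=> Ix; rewrite /W (int_w w0 wni Wfin Ix).
have V0 := V_gt0 w0 wni Wfin.
pose C : R := Num.max 0%R (fine S).
have hC x : I_a a x -> \int[leb]_(t in oo 0 x%:E) decr (I_a a) h t <= C%:E * W w x.
  move=> Ix; have /= le : \int[leb]_(t in oo 0 x%:E) decr (I_a a) h t / W w x <= S.
    by apply: ereal_sup_ubound; exists x.
  have Vx := V0 _ Ix; rewrite (WE _ Ix) inver gt_eqF// in le *.
  have ge : 0 <= \int[leb]_(t in oo 0 x%:E) decr (I_a a) h t by apply: integral_ge0 => t
    _; exact: rearr_ge0.
  have S0 : 0 <= S by apply: le_trans le; rewrite mule_ge0// lee_fin invr_ge0 ltW.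
  have Sfin : S \is a fin_num by rewrite ge0_fin_numE.
  rewrite -lee_pdivrMr//; apply: le_trans le _.
  by rewrite -(fineK Sfin) lee_fin /C le_max lexx orbT.
(* The L_1 part supplies the constant; the doubled coefficient reflects the two copies in
   [int_decr_add_le]. *)
exists (fine (\int[leb]_(x in I_a a) `|(g x)%:E|)), (C + C)%R.
have C0 : (0 <= C)%R by rewrite le_max lexx.
have gi0 : 0 <= \int[leb]_(x in I_a a) `|(g x)%:E| by apply: integral_ge0 => t _;
  exact: abse_ge0.
split; [exact: fine_ge0|exact: addr_ge0|move=> x Ix].
have /andP[+ xa] := Ix; rewrite lte_fin => x0.
have hx : decr (I_a a) h x < +oo.
  apply: (@h_lty R a (decr (I_a a) h)) => //.
  - by move=> t _; exact: rearr_ge0.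
  - by move=> s t _ _; exact: rearr_noninc.
  - by move=> t It; apply: le_lt_trans (hC _ It) _; rewrite (WE _ It) -EFinM ltry.
apply: le_trans (int_decr_add_le mI mf mg mh fgh x0 hx) _.
rewrite fineK; last by rewrite ge0_fin_numE.
apply: leeD => //.
have Vx := V0 _ Ix; have := hC _ Ix; rewrite (WE _ Ix) -!EFinM => le.
by rewrite mulrDl EFinD; apply: leeD.
Qed.

Lemma inf_min (R : realType) (S : set R) (m : R) : S m -> (forall x, S x -> (m <= x)%R) ->
  inf S = m.
Proof.
move=> Sm le; apply/eqP; rewrite eq_le; apply/andP; split.
  by apply: ge_inf => //; exists m.
by apply: lb_le_inf => //; exists m.
Qed.

Theorem theorem6p11 (R : realType) (a : \bar R) (w : R -> R)
    (E : set (R -> R)) (N : (R -> R) -> R) (f : R -> R)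
    (a_gt0 : 0 < a)
    (w_gt0 : forall t : R, I_a a t -> (0 < w t)%R)
    (w_decreasing : forall s t : R, I_a a s -> I_a a t -> (s <= t)%R ->
       (w t <= w s)%R)
    (W_finite : forall t : R, I_a a t -> W w t < +oo)
    (E_bfs : banach_function_space (J_w a w) E N)
    (E_fully_symmetric : fully_symmetric (J_w a w) E N)
    (f_L1_plus_M_W : L1_plus_M_W a w f) :
  (Q_Ew a w E f <-> fin_mem (I_a a) (M_Ew a w E) (level_fun a w f)) /\
  (Q_Ew a w E f ->
     gauge_Q_Ew a w E N f = gauge_M_Ew a w N (fine \o level_fun a w f)).
Proof.
have [C1 [C2 [C10 C20 fb]]] := L1_plus_M_W_bound a_gt0 w_gt0 w_decreasing W_finite
  f_L1_plus_M_W.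
have mf : L0 (I_a a) f by case: f_L1_plus_M_W.
have [Phi [k [least FPhi k0 kni [intk aek]]]] :=
  level_fun_envelope a_gt0 w_gt0 w_decreasing W_finite mf C10 C20 fb.
have FE t : I_a a t ->
    \int[leb]_(s in oo 0 t%:E) decr (I_a a) f s = (prim (decr (I_a a) f) t)%:E.
  move=> It; have /andP[t0 ta] := It; apply: (primE (a := a)).
  - by move=> s _; exact: rearr_ge0.
  - by move=> s s' _ _; exact: rearr_noninc.
  - exact: (fs_fin w_gt0 w_decreasing W_finite fb).
  - by rewrite -lee_fin ltW.
  - exact: ltW.
set I := I_a a; set J := J_w a w; set f0 := fine \o level_fun a w f.
pose V := prim (fun t : R => (w t)%:E).
pose ft x := (k x * w x)%R.
have mI := measurable_I a.
have mk : L0 I k := L0_noninc kni.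
have ft0 x : I x -> (0 <= ft x)%R by move=> Ix; rewrite mulr_ge0 ?k0// ltW// w_gt0.
have ftni x y : I x -> I y -> (x <= y)%R -> (ft y <= ft x)%R.
  by move=> Ix Iy xy; apply: ler_pM;
    [exact: k0|by rewrite ltW// w_gt0|exact: kni|exact: w_decreasing].
have mft : L0 I ft := L0_noninc ftni.
have f0ae : ae_on I (fun x => ft x = f0 x).
  by apply: (ae_on1 aek) => x Ix; rewrite /f0 /= => ->.
have mf0 : L0 I f0 := L0_ae mft f0ae.
have df0 : decr I f0 = decr I ft by apply/esym; exact: eq_decr_ae.
have dft := decr_noninc_ae ft0 ftni.
pose k' := fine \o decr_div_w a w f0.
have divE : ae_on I (fun x => decr_div_w a w f0 x = (k x)%:E).
  apply: (ae_on1 dft) => x Ix; rewrite /decr_div_w -/I df0 => ->.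
  by rewrite inver gt_eqF ?w_gt0// -EFinM /ft mulfK// gt_eqF// w_gt0.
have kk' : ae_on I (fun x => k x = k' x) by apply: (ae_on1 divE) => x Ix;
  rewrite /k' /= => ->.
have mk' : L0 I k' := L0_ae mk kk'.
(* [k'] is the function f0^*/w of the definition of M_{E,w}; it agrees with [k] off a null set, so
   the gauge of [f0] is the norm of k^{*,w}. *)
have dk' : decr_w a w k' = decr_w a w k.
  apply: eq_rearr => s s0; rewrite !distr_wlebE; apply/esym; apply: eq_mass_ae => //.
  - exact: (L0_noninc w_decreasing).
  - by move=> x Ix; rewrite ltW// w_gt0.
have dk_fin u : J u -> decr_w a w k u < +oo.
  exact: (decr_w_lty a_gt0 w_gt0 w_decreasing W_finite k0 kni).
have reg h : L0 I h -> regular_distr I (wleb a w) h.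
  exact: (regular_decr_w w_gt0 w_decreasing).
have L0J h : (forall u, J u -> decr_w a w h u < +oo) -> L0 J (fine \o decr_w a w h).
  move=> fin; apply: L0_fine => [u Ju|u v _ _]; last exact: rearr_noninc.
  by rewrite ge0_fin_numE ?rearr_ge0//; exact: fin.
have decrJ h : L0 I h -> (forall u, J u -> decr_w a w h u < +oo) ->
    decr J (fine \o decr_w a w h) = decr_w a w h.
  move=> mh fin; apply: eq_rearr => s s0.
  apply: distr_rearr; [exact: reg|by move=> s'; exact: distr_w_le|exact: fin|exact: s0].
(* Both the membership and the lower bound for the gauge come from this claim, full symmetry
   yielding the two at once. *)
have below g : M_Ew a w E g -> subm I f g ->
    E (fine \o decr_w a w k) /\ (N (fine \o decr_w a w k) <= gauge_M_Ew a w N g)%R.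
  move=> [mg [gfin [mh [hfin hE]]]] fg.
  have gty t : I t -> decr I g t < +oo by exact: (decr_div_w_lty w_gt0 gfin).
  set h := fine \o decr_div_w a w g in mh hfin hE *.
  have hty u : J u -> decr_w a w h u < +oo by exact: rearr_lty hfin.
  have fs := fs_subm E_fully_symmetric.
  change (E (fine \o decr_w a w k) /\ (N (fine \o decr_w a w k) <= N (fine \o decr_w a w
    h))%R).
  apply: (fs _ _ (L0J _ dk_fin) hE).
  (* On J both functions are their own rearrangements, and every [u] is some [V x], which brings the
     comparison back to I. *)
  move=> u Ju; rewrite (decrJ k mk dk_fin) (decrJ h mh hty).
  have [x Ix <-] := V_onto a_gt0 w_gt0 w_decreasing W_finite Ju.
  apply: le_trans (int_decr_w_le w_gt0 w_decreasing W_finite k0 kni Ix) _.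
  rewrite (intk x Ix).
  apply: (least_majorant_le w_gt0 w_decreasing W_finite (F := prim (decr I f)) Ix).
  - by move=> p m H; exact: least.
  - exact: prim0.
  - move=> t It; apply: le_trans (int_decr_le_decr_w w_gt0 w_decreasing W_finite gty It).
    apply: le_trans (fg t It).
    by rewrite (FE t It).
have MQ : E (fine \o decr_w a w k) -> M_Ew a w E f0.
  move=> Ek; split; first exact: mf0.
  split; first by apply: (ae_on1 divE) => x Ix ->.
  split; first exact: mk'.
  split; last by rewrite -/k' dk'.
  by apply: ae_onT => u Ju; rewrite -/k' dk' ge0_fin_numE ?rearr_ge0//; exact: dk_fin.
have gf0 : gauge_M_Ew a w N f0 = N (fine \o decr_w a w k) by rewrite /gauge_M_Ew
  /norm_E_w -/k' dk'.
have submf0 : subm I f f0.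
  move=> x Ix; rewrite df0; have /andP[x0 xa] := Ix.
  rewrite (FE x Ix).
  apply: (@le_trans _ _ (Phi x)%:E); first by rewrite lee_fin FPhi.
  rewrite -(intk x Ix).
  have sub := oo_sub_I (lexx 0%R) (ltW xa).
  apply: ae_ge0_le_integral.
  - exact: measurable_oo.
  - by move=> t /sub It; rewrite lee_fin ft0.
  - exact: (measurable_sub_I mft (lexx 0%R) (ltW xa)).
  - by move=> t _; exact: rearr_ge0.
  - exact: measurable_rearr.
  - apply: (@ae_on_subset _ _ I) sub _.
    by apply: (ae_on1 dft) => t It ->.
split; [split|].
- move=> [_ [g Mg fg]]; split; first by apply: (ae_on1 aek) => x Ix ->.
  by apply: MQ; have [] := below _ Mg fg.
- by move=> [_ Mf0]; split; [exact: mf|exact: (ex_intro2 _ _ f0 Mf0 submf0)].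
move=> [_ [g Mg fg]].
have Mf0 : M_Ew a w E f0 by apply: MQ; have [] := below _ Mg fg.
(* The infimum is attained: f0 itself is admissible. *)
apply: inf_min; first exact: (ex_intro2 _ _ f0 (conj Mf0 submf0) erefl).
by move=> _ [g' [Mg' fg'] <-]; rewrite gf0; exact: (below _ Mg' fg').2.
Qed.
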